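(* Let $A$ be an artin $R$-algebra and let $M\in\mathrm{mod}(A)$. Then $\phi(M)$ is the maximum of the set consisting of $0$ together with all positive integers $d$ for which there exists a pair $(X,Y)$ of objects in $\mathrm{add}(M)$ satisfying the following three conditions: (a) $\mathrm{add}(X)\cap\mathrm{add}(Y)=\{0\}$; (b) $\mathrm{Tor}^A_d(-,X)\not\simeq\mathrm{Tor}^A_d(-,Y)$ in $\mathcal{C}_{A^{op}}$; (c) $\mathrm{Tor}^A_{d+1}(-,X)\simeq\mathrm{Tor}^A_{d+1}(-,Y)$ in $\mathcal{C}_{A^{op}}$.
   Context: $R$ is a commutative artinian ring, $\mathrm{mod}(A)$ is the category of finitely generated left $A$-modules, and $\mathcal{C}_{A^{op}}$ denotes the category of all $R$-functors (i.e. $R$-linear functors) $F:\mathrm{mod}(A^{op})\to\mathrm{mod}(R)$. For $M\in\mathrm{mod}(A)$, $\mathrm{add}(M)$ is the class of direct summands of finite direct sums of copies of $M$. Igusa-Todorov function $\phi$: Let $K(A)$ be the quotient of the free abelian group generated by the isomorphism classes $[M]$ of modules $M\in\mathrm{mod}(A)$ modulo the relations (a) $[N]-[S]-[T]$ if $N\simeq S\oplus T$ and (b) $[P]$ if $P$ is projective. Thus $K(A)$ is the free abelian group on the isomorphism classes of finitely generated indecomposable non-projective $A$-modules. The syzygy induces a group homomorphism $\Omega:K(A)\to K(A)$, $\Omega([M]):=[\Omega(M)]$. Let $\langle M\rangle$ be the subgroup of $K(A)$ generated by the indecomposable non-projective direct summands of $M$. Then $\phi(M)$ is the smallest non-negative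 integer such that $\Omega:\Omega^n(\langle M\rangle)\to\Omega^{n+1}(\langle M\rangle)$ is an isomorphism for all $n\geq\phi(M)$. *)

(* Defs.v *)
From HB Require Import structures.
From mathcomp Require Import all_boot all_algebra.
From mathcomp Require Import boolp classical_sets functions.
From mathcomp Require Import freeg.

Set Implicit Arguments.
Unset Strict Implicit.
Unset Printing Implicit Defensive.

Import GRing.Theory.
Local Open Scope ring_scope.
Local Open Scope quotient_scope.

Section Modules.
Variable A : nzRingType.
Implicit Types M N P S T X : lmodType A.

Definition fingen M : Prop :=
  exists s : seq M, forall x : M,
    exists c : 'I_(size s) -> A, x = \sum_i c i *: s`_i.

Definition surj M N (f : M -> N) : Prop := forall y, exists x, f x = y.

Definition miso M N : Prop := exists f : {linear M -> N}, bijective f.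

Definition is_zero M : Prop := forall x : M, x = 0.

Definition summand X M : Prop := exists T, miso (X * T)%type M.

Definition in_add M X : Prop := exists n, summand X {ffun 'I_n -> M}.

Definition projective P : Prop :=
  forall (M N : lmodType A) (g : {linear M -> N}) (f : {linear P -> N}),
    surj g -> exists h : {linear P -> M}, forall x, g (h x) = f x.

Definition indecomposable M : Prop :=
  ~ is_zero M /\ forall S T, miso M (S * T)%type -> is_zero S \/ is_zero T.

(* A projective cover: an epimorphism p from a projective module which is
   essential, i.e. p \o g epi forces g epi. *)
Definition proj_cover P M (p : {linear P -> M}) : Prop :=
  [/\ projective P, surj p
    & forall (U : lmodType A) (g : {linear U -> P}), surj (p \o g) -> surj g].

(* N is (isomorphic to) Omega(M), the kernel of a projective cover of M; this
   determines N up to isomorphism. *)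
Definition is_syzygy M N : Prop :=
  exists (P : lmodType A) (p : {linear P -> M}) (i : {linear N -> P}),
    [/\ proj_cover p, injective i & forall x, p x = 0 <-> exists y, i y = x].

End Modules.

Record fgmod (A : nzRingType) := FGMod {
  fgmod_sort :> lmodType A;
  fgmodP : fingen fgmod_sort }.

Definition artinian (R : comNzRingType) : Prop :=
  forall I : nat -> {pred R^o},
    (forall n, submod_closed (I n)) ->
    (forall n, {subset I n.+1 <= I n}) ->
    exists n, forall m, (n <= m)%N -> I m =i I n.

Definition artin_algebra (R : comNzRingType) (A : algType R) : Prop :=
  artinian R /\ fingen (A : lmodType R).

Section Quotient.
Variables (R : nzRingType) (V : lmodType R) (G : set V).

(* The smallest submodule containing G. *)
Definition mspan : {pred V} := fun x =>
  `[< forall S : {pred V}, submod_closed S -> (forall y, G y -> y \in S) ->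
      x \in S >].

Lemma mspan_submod : submod_closed mspan.
Proof.
split; first by apply/asboolP => S [].
move=> a x y /asboolP Sx /asboolP Sy; apply/asboolP => S cS GS.
by case: (cS) => _; apply; [exact: Sx | exact: Sy].
Qed.

HB.instance Definition _ := GRing.isSubmodClosed.Build R V mspan mspan_submod.

Lemma mspan_gen x : G x -> x \in mspan.
Proof. by move=> Gx; apply/asboolP => S _; apply. Qed.

(* V modulo the submodule generated by G. *)
Definition mquot := Quotient.quot mspan.

HB.instance Definition _ := GRing.Zmodule.on mquot.
HB.instance Definition _ := EqQuotient.on mquot.

Definition mproj (x : V) : mquot := \pi_mquot x.

Lemma mprojP x y : reflect (mproj x = mproj y) (x - y \in mspan).
Proof. by rewrite /mproj (Quotient.idealrBE mspan); apply/eqP. Qed.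

Lemma mproj_repr (u : mquot) : mproj (repr u) = u.
Proof. exact: reprK. Qed.

Lemma mproj_zmod : zmod_morphism mproj.
Proof. exact: (raddfB (\pi_(Quotient.quot mspan))). Qed.

HB.instance Definition _ := GRing.isZmodMorphism.Build V mquot mproj mproj_zmod.

Definition mquot_scale (a : R) (u : mquot) : mquot := mproj (a *: repr u).

Lemma mquot_scaleE a x : mquot_scale a (mproj x) = mproj (a *: x).
Proof.
by apply/mprojP; rewrite -scalerBr rpredZ //; apply/mprojP; rewrite mproj_repr.
Qed.

Fact mquot_scaleA a b u :
  mquot_scale a (mquot_scale b u) = mquot_scale (a * b) u.
Proof. by rewrite -(mproj_repr u) !mquot_scaleE scalerA. Qed.
Fact mquot_scale1 : left_id 1 mquot_scale.
Proof. by move=> u; rewrite -(mproj_repr u) !mquot_scaleE scale1r. Qed.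
Fact mquot_scaleDr : right_distributive mquot_scale +%R.
Proof.
move=> a u v; rewrite -(mproj_repr u) -(mproj_repr v).
by rewrite !mquot_scaleE -!raddfD mquot_scaleE scalerDr raddfD.
Qed.
Fact mquot_scaleDl v : {morph mquot_scale^~ v : a b / a + b}.
Proof.
by move=> a b; rewrite -(mproj_repr v) !mquot_scaleE scalerDl raddfD.
Qed.

HB.instance Definition _ := GRing.Zmodule_isLmodule.Build R mquot
  mquot_scaleA mquot_scale1 mquot_scaleDr mquot_scaleDl.

Lemma mproj_scalable : scalable mproj.
Proof. by move=> a x; rewrite -mquot_scaleE. Qed.

HB.instance Definition _ :=
  GRing.isScalable.Build R V mquot _ mproj mproj_scalable.

End Quotient.

Section QuotientLift.
Variables (R : nzRingType) (V W : lmodType R) (G : set V).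

Definition mquot_lift (f : {linear V -> W}) of (forall x, G x -> f x = 0) :=
  fun u : mquot G => f (repr u).

Variables (f : {linear V -> W}) (f0 : forall x, G x -> f x = 0).

Lemma mquot_liftE x : mquot_lift f0 (mproj G x) = f x.
Proof.
rewrite /mquot_lift; apply/eqP; rewrite -subr_eq0 -raddfB.
have /mprojP/asboolP := mproj_repr (mproj G x).
move=> /(_ [pred z | f z == 0]); apply.
  split; first by rewrite inE raddf0.
  move=> a y z; rewrite !inE => /eqP fy /eqP fz.
  by rewrite linearP fy fz scaler0 addr0.
by move=> y Gy; rewrite inE f0.
Qed.

Lemma mquot_lift_linear : linear (mquot_lift f0).
Proof.
move=> a u v; rewrite -(mproj_repr u) -(mproj_repr v) -linearP.
by rewrite !mquot_liftE linearP.
Qed.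

HB.instance Definition _ := GRing.isLinear.Build R (mquot G) W _ (mquot_lift f0)
  mquot_lift_linear.
End QuotientLift.

Section QuotientMap.
Variables (R : nzRingType) (V W : lmodType R) (G : set V) (H : set W).
Variables (f : {linear V -> W}) (fGH : forall x, G x -> f x \in mspan H).

Fact mquot_map_subproof x : G x -> (mproj H \o f) x = 0.
Proof.
by move=> Gx; rewrite /= -(raddf0 (mproj H)); apply/mprojP; rewrite subr0 fGH.
Qed.

Definition mquot_map : {linear mquot G -> mquot H} :=
  mquot_lift mquot_map_subproof.

Lemma mquot_mapE x : mquot_map (mproj G x) = mproj H (f x).
Proof. exact: mquot_liftE. Qed.
End QuotientMap.

Section Kernel.
Variables (R : nzRingType) (U V : lmodType R) (f : {linear U -> V}).

Definition ker_pred : {pred U} := fun x => f x == 0.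

Lemma ker_submod : submod_closed ker_pred.
Proof.
split; first by rewrite unfold_in raddf0.
move=> a x y; rewrite !unfold_in => /eqP fx /eqP fy.
by rewrite linearP fx fy scaler0 addr0.
Qed.

HB.instance Definition _ := GRing.isSubmodClosed.Build R U ker_pred ker_submod.

Record mker := MKer { mker_val : U; mkerP : mker_val \in ker_pred }.

HB.instance Definition _ := [isSub for mker_val].
HB.instance Definition _ := [Choice of mker by <:].
HB.instance Definition _ := [SubChoice_isSubLmodule of mker by <:].
HB.instance Definition _ :=
  GRing.isLinear.Build R mker U _ mker_val (linearP (val : mker -> U)).
End Kernel.

Section KernelMap.
Variables (R : nzRingType) (U V U' V' : lmodType R).
Variables (f : {linear U -> V}) (f' : {linear U' -> V'}).
Variables (u : {linear U -> U'}) (v : {linear V -> V'}).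
Hypothesis uv : forall x, f' (u x) = v (f x).

Fact mker_map_subproof (x : mker f) : u (val x) \in ker_pred f'.
Proof.
by rewrite unfold_in uv; have /eqP -> := mkerP x; rewrite raddf0.
Qed.

Definition mker_map (x : mker f) : mker f' := MKer (mker_map_subproof x).

Lemma mker_map_linear : linear mker_map.
Proof. by move=> a x y; apply: val_inj; rewrite /= !linearP. Qed.

HB.instance Definition _ := GRing.isLinear.Build R (mker f) (mker f') _ mker_map
  mker_map_linear.
End KernelMap.

Section Free.
Variables (R : nzRingType) (K : choiceType) (M : lmodType R) (f : K -> M).

Fact fglift_zmod : zmod_morphism (fglift f : {freeg K / R} -> M).
Proof. exact: lift_is_additive. Qed.

HB.instance Definition _ :=
  GRing.isZmodMorphism.Build {freeg K / R} M (fglift f) fglift_zmod.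

Fact fglift_scalable : scalable (fglift f : {freeg K / R} -> M).
Proof.
move=> a D; pose F : {additive {freeg K / R} -> M} := fglift f.
rewrite -[fglift f _]/(F _) -[fglift f D]/(F D).
have FZ b c x : F (b *: << c *g x >>) = b *: F << c *g x >>.
  have -> : b *: << c *g x >> = << b * c *g x >> :> {freeg K / R}.
    by apply/eqP/freeg_eqP => y; rewrite coeffZ !coeffU mulrA.
  by rewrite /F /= !liftU scalerA.
rewrite -[D]freeg_sumE scaler_sumr !raddf_sum.
by apply: eq_bigr => x _; exact: FZ.
Qed.

HB.instance Definition _ :=
  GRing.isScalable.Build R {freeg K / R} M _ (fglift f) fglift_scalable.

Lemma fgliftE k : fglift f (<< k >> : {freeg K / R}) = f k.
Proof. by rewrite liftU scale1r. Qed.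
End Free.

Lemma freeg_ext (R : nzRingType) (K : choiceType) (M : lmodType R)
    (f g : {linear {freeg K / R} -> M}) :
  (forall k, f << k >> = g << k >>) -> f =1 g.
Proof.
move=> fg D; rewrite -[D]freeg_sumE !raddf_sum; apply: eq_bigr => x _ /=.
have -> : << coeff x D *g x >> = coeff x D *: << x >> :> {freeg K / R}.
  by apply/eqP/freeg_eqP => y; rewrite coeffZ !coeffU mul1r.
by rewrite !linearZ fg.
Qed.

(* Right A-modules are left modules over the converse ring A^c: for z : Z with
   Z : lmodType A^c, the element (a : A^c) *: z is z.a. *)
Section Tensor.
Variables (R : comNzRingType) (A : algType R).
Implicit Types (Z : lmodType A^c) (P : lmodType A).

(* The R-module structure that a right A-module inherits from R -> A. *)
Definition rscale Z (r : R) (z : Z) : Z := ((r%:A : A) : A^c) *: z.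

Definition ptens Z P (z : Z) (p : P) :
  {freeg (Z * P)%type / R} := << (z, p) >>.

(* Z (x)_A P is presented as an R-module: free on the pairs (z, p), modulo
   biadditivity, A-balancedness and compatibility with the R-action. *)
Inductive tens_rel Z P : {freeg (Z * P)%type / R} -> Prop :=
| TensAddl z z' p : tens_rel (ptens (z + z') p - (ptens z p + ptens z' p))
| TensAddr z p p' : tens_rel (ptens z (p + p') - (ptens z p + ptens z p'))
| TensBal z (a : A) p :
    tens_rel (ptens ((a : A^c) *: z : Z) p - ptens z (a *: p))
| TensScale r z p : tens_rel (ptens (rscale r z) p - r *: ptens z p).

Definition tens Z P := mquot (@tens_rel Z P).

HB.instance Definition _ Z P := GRing.Lmodule.on (tens Z P).

Definition tpure Z P (z : Z) (p : P) : tens Z P :=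
  mproj (@tens_rel Z P) (ptens z p).

Lemma tens_ext Z P (M : lmodType R) (f g : {linear tens Z P -> M}) :
  (forall z p, f (tpure z p) = g (tpure z p)) -> f =1 g.
Proof.
move=> fg u; rewrite -(mproj_repr u).
by apply: (@freeg_ext _ _ _ (f \o mproj _) (g \o mproj _)) => -[z p]; apply: fg.
Qed.

Lemma tpure_eq0 Z P x : tens_rel x -> mproj (@tens_rel Z P) x = 0.
Proof.
move=> hx; rewrite -(raddf0 (mproj _)).
by apply/mprojP; rewrite subr0 mspan_gen.
Qed.

Lemma tpureDl Z P (z z' : Z) (p : P) :
  tpure (z + z') p = tpure z p + tpure z' p.
Proof.
apply/eqP; rewrite -subr_eq0 /tpure -raddfD -raddfB; apply/eqP.
exact/tpure_eq0/TensAddl.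
Qed.

Lemma tpure_scale Z P r (z : Z) (p : P) : tpure (rscale r z) p = r *: tpure z p.
Proof.
apply/eqP; rewrite -subr_eq0 /tpure -linearZ -raddfB; apply/eqP.
exact/tpure_eq0/TensScale.
Qed.

Section Map.
Variables (Z Z' : lmodType A^c) (P P' : lmodType A).
Variables (f : {linear Z -> Z'}) (g : {linear P -> P'}).

Definition tmap_free :
  {linear {freeg (Z * P)%type / R} -> {freeg (Z' * P')%type / R}} :=
  fglift (fun zp : Z * P => ptens (f zp.1) (g zp.2)).

Fact tmap_subproof x : tens_rel x -> tmap_free x \in mspan (@tens_rel Z' P').
Proof.
have E z p : tmap_free (ptens z p) = ptens (f z) (g p) by exact: fgliftE.
have EZ r z p : tmap_free (r *: ptens z p) = r *: ptens (f z) (g p).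
  by rewrite -E linearZ.
case=> [z z' p|z p p'|z a p|r z p]; apply: mspan_gen; rewrite raddfB.
- by rewrite raddfD /= !E raddfD; exact: TensAddl.
- by rewrite raddfD /= !E raddfD; exact: TensAddr.
- by rewrite /= !E !linearZ; exact: TensBal.
- by rewrite /= E EZ /rscale linearZ; exact: TensScale.
Qed.

Definition tmap : {linear tens Z P -> tens Z' P'} := mquot_map tmap_subproof.

Lemma tmapE z p : tmap (tpure z p) = tpure (f z) (g p).
Proof. by rewrite /tmap /tpure mquot_mapE; congr mproj; exact: fgliftE. Qed.
End Map.

Lemma tmap_square Z Z' P P' (f : {linear Z -> Z'}) (g : {linear P -> P'}) x :
  tmap (idfun : {linear Z' -> Z'}) g (tmap f (idfun : {linear P -> P}) x) =
  tmap f (idfun : {linear P' -> P'}) (tmap (idfun : {linear Z -> Z}) g x).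
Proof.
pose a : {linear tens Z P -> tens Z' P'} := tmap idfun g \o tmap f idfun.
pose b : {linear tens Z P -> tens Z' P'} := tmap f idfun \o tmap idfun g.
apply: (@tens_ext _ _ _ a b) => z p.
by rewrite -[a _]/(tmap _ _ (tmap _ _ _)) -[b _]/(tmap _ _ (tmap _ _ _)) !tmapE.
Qed.

End Tensor.

Section Homology.
Variables (R : nzRingType) (U V W : lmodType R).
Variables (f : {linear U -> V}) (g : {linear V -> W}).

(* The cycles k in ker g that lie in the image of f. *)
Definition hbound : set (mker g) := [set k | exists u, mker_val k = f u].

Definition homology := mquot hbound.

HB.instance Definition _ := GRing.Lmodule.on homology.

Definition hclass (k : mker g) : homology := mproj hbound k.
End Homology.

Section HomologyMap.
Variables (R : nzRingType) (U V W U' V' W' : lmodType R).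
Variables (f : {linear U -> V}) (g : {linear V -> W}).
Variables (f' : {linear U' -> V'}) (g' : {linear V' -> W'}).
Variables (u : {linear U -> U'}) (v : {linear V -> V'}) (w : {linear W -> W'}).
Hypothesis fvu : forall x, f' (u x) = v (f x).
Hypothesis gwv : forall x, g' (v x) = w (g x).

Fact hmap_subproof k :
  hbound f k -> mker_map gwv k \in mspan (@hbound _ _ _ _ f' g').
Proof. by case=> x kx; apply: mspan_gen; exists (u x); rewrite /= fvu -kx. Qed.

Definition hmap : {linear homology f g -> homology f' g'} :=
  mquot_map hmap_subproof.

Lemma hmapE k : hmap (hclass f k) = hclass f' (mker_map gwv k).
Proof. exact: mquot_mapE. Qed.
End HomologyMap.

(* Tor_n(Z, X) = H_n(Z (x)_A F_.), where ... -> F_1 -> F_0 -> X is the standard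
   free resolution of X: F_n is free on the underlying set of the n-th kernel
   nsyz n X, with nsyz 0 X = X.  These kernels are auxiliary and are not the
   (minimal) syzygies of X. *)
Section Tor.
Variables (R : comNzRingType) (A : algType R).
Implicit Types X : lmodType A.
Implicit Types Z : lmodType A^c.

Definition free_cover X : {linear {freeg X / A} -> X} := fglift idfun.

Fixpoint nsyz n X : lmodType A :=
  if n is m.+1 then mker (free_cover (nsyz m X)) else X.

Definition res n X : lmodType A := {freeg (nsyz n X) / A}.

Definition dif n X : {linear res n.+1 X -> res n X} :=
  mker_val (f := free_cover (nsyz n X)) \o free_cover (nsyz n.+1 X).

(* The resolution is continued by 0 in degree -1, so Tor_0 is a cokernel. *)
Definition res_pred n X : lmodType A := if n is m.+1 then res m X else 'rV[A]_0.

Definition dif_out n X : {linear res n X -> res_pred n X} :=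
  if n is m.+1 then dif m X else \0.

Definition Tor n Z X : lmodType R :=
  homology (tmap (idfun : {linear Z -> Z}) (dif n X))
           (tmap (idfun : {linear Z -> Z}) (dif_out n X)).

Definition Tor_map n X Z Z' (f : {linear Z -> Z'}) :
    {linear Tor n Z X -> Tor n Z' X} :=
  hmap (tmap_square f (dif n X)) (tmap_square f (dif_out n X)).

Lemma Tor_ind n Z X (Q : Tor n Z X -> Prop) :
  (forall k, Q (hclass _ k)) -> forall t, Q t.
Proof. by move=> h t; rewrite -(mproj_repr t); exact: h. Qed.

Lemma Tor_mapE n X Z Z' (f : {linear Z -> Z'}) k :
  Tor_map n X f (hclass _ k) =
  hclass _ (mker_map (tmap_square f (dif_out n X)) k).
Proof. exact: hmapE. Qed.

Lemma Tor_map_id n X Z (t : Tor n Z X) :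
  Tor_map n X (idfun : {linear Z -> Z}) t = t.
Proof.
elim/Tor_ind: t => k; rewrite Tor_mapE; congr hclass; apply: val_inj.
pose T := tens Z (res n X).
apply: (@tens_ext _ _ _ _ _ (tmap idfun idfun : {linear T -> T}) idfun) => z p.
exact: tmapE.
Qed.

Lemma Tor_map_comp n X Z Z' Z'' (f : {linear Z -> Z'})
    (g : {linear Z' -> Z''}) t :
  Tor_map n X (g \o f) t = Tor_map n X g (Tor_map n X f t).
Proof.
elim/Tor_ind: t => k; rewrite !Tor_mapE; congr hclass; apply: val_inj.
pose h : {linear tens Z (res n X) -> tens Z'' (res n X)} :=
  tmap g idfun \o tmap f idfun.
have E : tmap (g \o f) (idfun : {linear res n X -> res n X}) =1 h.
  apply: tens_ext => z p.
  by rewrite -[h _]/(tmap _ _ (tmap _ _ _)) !tmapE.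
exact: E.
Qed.

Lemma Tor_map_linear n X Z Z' r (f g h : {linear Z -> Z'}) :
  (forall z, h z = rscale r (f z) + g z) ->
  forall t, Tor_map n X h t = r *: Tor_map n X f t + Tor_map n X g t.
Proof.
move=> hE; elim/Tor_ind => k; rewrite !Tor_mapE -linearP; congr hclass.
apply: val_inj.
pose T := tens Z (res n X); pose T' := tens Z' (res n X).
pose l : {linear T -> T'} := r \*: tmap f idfun \+ tmap g idfun.
have E : tmap h (idfun : {linear res n X -> res n X}) =1 l.
  apply: tens_ext => z p.
  rewrite -[l _]/(r *: tmap _ _ _ + tmap _ _ _) !tmapE.
  by rewrite hE tpureDl tpure_scale.
exact: E.
Qed.

End Tor.

Section Functors.
Variables (R : comNzRingType) (A : algType R).

(* R-linear functors mod(A^op) -> Mod(R).  Since mod(R) is a full subcategory of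
   Mod(R), isomorphism of two functors that take values in mod(R) is the same
   here as among functors to mod(R). *)
Record rfunctor := RFunctor {
  fobj : fgmod A^c -> lmodType R;
  fmap : forall Z Z' : fgmod A^c,
    {linear Z -> Z'} -> {linear fobj Z -> fobj Z'};
  fmap_id : forall (Z : fgmod A^c) x, fmap (idfun : {linear Z -> Z}) x = x;
  fmap_comp : forall (Z Z' Z'' : fgmod A^c)
    (f : {linear Z -> Z'}) (g : {linear Z' -> Z''}) x,
    fmap (g \o f : {linear Z -> Z''}) x = fmap g (fmap f x);
  fmap_linear : forall (Z Z' : fgmod A^c) r (f g h : {linear Z -> Z'}),
    (forall z, h z = rscale r (f z) + g z) ->
    forall x, fmap h x = r *: fmap f x + fmap g x }.

Definition nat_iso (F G : rfunctor) : Prop :=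
  exists eta : forall Z : fgmod A^c, {linear fobj F Z -> fobj G Z},
    (forall Z, bijective (eta Z)) /\
    (forall (Z Z' : fgmod A^c) (f : {linear Z -> Z'}) x,
      eta Z' (fmap F f x) = fmap G f (eta Z x)).

Definition TorF (d : nat) (X : lmodType A) : rfunctor :=
  @RFunctor (fun Z => Tor d Z X) (fun Z Z' f => Tor_map d X f)
    (fun Z => @Tor_map_id R A d X Z)
    (fun Z Z' Z'' => @Tor_map_comp R A d X Z Z' Z'')
    (fun Z Z' => @Tor_map_linear R A d X Z Z').

End Functors.

Section IgusaTodorov.
Variable A : nzRingType.

(* The type fgmod A is large, hence cannot index a free abelian group in the
   universe of its elements.  K(A) is therefore generated by the presentations
   A^n / <G>, which represent every isomorphism class of mod(A). *)
Definition fgcode : Type := {n : nat & set 'rV[A]_n}.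

Definition decode (c : fgcode) : lmodType A := mquot (projT2 c).

Definition code_free : lmodType int := {freeg {classic fgcode} / int}.

Definition code_gen (c : fgcode) : code_free := << (c : {classic fgcode}) >>.

(* Isomorphic modules get the same class: take T zero in KSum and P zero in
   KProj. *)
Inductive K_rel : code_free -> Prop :=
| KSum N S T : miso (decode N) (decode S * decode T)%type ->
    K_rel (code_gen N - code_gen S - code_gen T)
| KProj P : projective (decode P) -> K_rel (code_gen P).

Definition Kgroup : lmodType int := mquot K_rel.

Definition Kclass (c : fgcode) : Kgroup := mproj K_rel (code_gen c).

Definition is_syzygy_map (w : {additive Kgroup -> Kgroup}) : Prop :=
  forall M N, is_syzygy (decode M) (decode N) -> w (Kclass M) = Kclass N.

(* Over an artin algebra every object of mod(A) has a syzygy in mod(A), so the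
   condition [M] |-> [Omega M] has exactly one additive solution; \0 is only the
   default value of the definite description. *)
Definition Omega : {additive Kgroup -> Kgroup} :=
  if pselect (exists w, is_syzygy_map w) is left e then projT1 (cid e) else \0.

(* The subgroup <M> of K(A). *)
Definition Kspan (M : lmodType A) : set Kgroup :=
  [set x | x \in mspan [set y | exists c, y = Kclass c /\
    [/\ indecomposable (decode c), ~ projective (decode c)
      & summand (decode c) M]]].

(* Omega^n(<M>). *)
Definition OmegaK (n : nat) (M : lmodType A) : set Kgroup :=
  (iter n Omega) @` Kspan M.

Definition Omega_stable (M : lmodType A) (n : nat) : Prop :=
  forall m, (n <= m)%N -> set_bij (OmegaK m M) (OmegaK m.+1 M) Omega.

(* The least such n; 0 is only the default value of xget. *)
Definition phi (M : lmodType A) : nat :=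
  xget 0%N [set n | Omega_stable M n /\
    forall k, Omega_stable M k -> (n <= k)%N].

End IgusaTodorov.

Definition is_max (S : set nat) (m : nat) : Prop :=
  S m /\ forall d, S d -> (d <= m)%N.

(* Main.v *)
From HB Require Import structures.
From mathcomp Require Import all_boot all_algebra.
From mathcomp Require Import boolp classical_sets functions.
From mathcomp Require Import freeg.
Require Import Defs.

Set Implicit Arguments.
Unset Strict Implicit.
Unset Printing Implicit Defensive.

Import GRing.Theory.
Local Open Scope ring_scope.
Local Open Scope classical_set_scope.

(** Write [X ~ Y] when [X] and [Y] are stably isomorphic, that is, isomorphic
    modulo maps that factor through projective modules. The proof rests on two
    facts about finitely generated modules over an artin algebra [A].

    - The classes of [X] and [Y] in K(A) agree if and only if [X ~ Y]
      ([stiso_Kclass], [Kclass_stiso]). The relations of K(A) only give [T + X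
      ~ T + Y] for some [T]; this is cancelled by the Krull-Schmidt property,
      which comes from Fitting's lemma.
    - The functors [Tor_1(-, X)] and [Tor_1(-, Y)] are isomorphic if and only
      if [X ~ Y] ([stiso_tor], [tor_stiso]). If [X] has relation matrix [B]
      and [Tr X] is the right module with relation matrix the transpose of
      [B], then [Tor_1(-, X)] is the quotient of [Hom (Tr X, -)] by the maps
      that factor through free modules along relations between the rows of
      [B]. Following the identity of [Tr X] through a natural isomorphism
      gives maps between [Tr X] and [Tr Y] that are inverse to each other up
      to such maps, and their matrices also yield mutually inverse stable maps
      between [X] and [Y].

    By dimension shifting [Tor_{n+1}(-, X)] is [Tor_1] of the [n]-th syzygy of
    [X], so that [Tor_{n+1}(-, X)] and [Tor_{n+1}(-, Y)] are isomorphic if and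
    only if the [n]-th power of [Omega] takes the same value on the classes of
    [X] and [Y] ([tor_iso_Omega]).

    Now [phi M] is the least [n] from which on [Omega] is injective on
    [Omega^m <M>], which exists because [<M>] is a finitely generated abelian
    group. A pair [(X, Y)] in add(M) as in the theorem gives the element [x =
    [X] - [Y]] of [<M>] with [Omega^(d-1) x <> 0] and [Omega^d x = 0], hence
    [d <= phi M]. Conversely, if [d = phi M] is positive, minimality gives
    such an [x] in [<M>]; writing it as a difference of sums of classes of
    indecomposable summands of [M], with as few terms as possible, leaves no
    isomorphic terms on the two sides, and the two sums are [X] and [Y]
    ([Kspan_reduced], [add_dsum_disjoint]). *)

(** * Submodules and chain conditions *)

Section Span.
Variables (S : nzRingType) (V : lmodType S).
Implicit Types (G : set V) (I J : {pred V}) (s : seq V).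

Lemma mspan_min G I : submod_closed I -> G `<=` [set x | x \in I] ->
  {subset mspan G <= I}.
Proof. by move=> cI GI x /asboolP; apply. Qed.

Lemma submod0 I : submod_closed I -> 0 \in I. Proof. by case. Qed.

Lemma submodZ I a x : submod_closed I -> x \in I -> a *: x \in I.
Proof. by case=> I0 /(_ a x 0) h Ix; rewrite -[_ *: _]addr0 h. Qed.

Lemma submodD I x y : submod_closed I -> x \in I -> y \in I -> x + y \in I.
Proof. by case=> _ /(_ 1 x y) h Ix Iy; rewrite -[x]scale1r h. Qed.

Lemma submodB I x y : submod_closed I -> x \in I -> y \in I -> x - y \in I.
Proof.
by move=> cI Ix Iy; rewrite submodD // -scaleN1r submodZ.
Qed.

Definition predI_submod I J : {pred V} := fun x => (x \in I) && (x \in J).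

Lemma in_predI_submod I J x : (x \in predI_submod I J) = (x \in I) && (x \in J).
Proof. by []. Qed.

Lemma setI_submod I J :
  submod_closed I -> submod_closed J -> submod_closed (predI_submod I J).
Proof.
move=> cI cJ; split; first by rewrite in_predI_submod !submod0.
move=> a x y; rewrite !in_predI_submod => /andP[Ix Jx] /andP[Iy Jy].
by rewrite !(submodD, submodZ).
Qed.

Definition gens s : set V := [set x | x \in s].

Lemma gens_nil x : x \in mspan (gens [::]) -> x = 0.
Proof.
move=> hx; apply/eqP; move: x hx; apply: (@mspan_min _ [pred z | z == 0]).
  by split=> [|a x y]; rewrite !inE // => /eqP -> /eqP ->;
    rewrite scaler0 addr0.
by move=> y; rewrite /gens /= in_nil.
Qed.

Lemma gens_cons v s x : x \in mspan (gens (v :: s)) ->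
  exists a y, y \in mspan (gens s) /\ x = a *: v + y.
Proof.
move=> hx; apply/asboolP; move: x hx.
apply: (@mspan_min _ (fun x => `[< _ >])).
  split; first by apply/asboolP; exists 0, 0; rewrite scale0r addr0 rpred0.
  move=> a x x' /asboolP[b [y [sy ->]]] /asboolP[c [y' [sy' ->]]].
  apply/asboolP; exists (a * b + c), (a *: y + y').
  by rewrite rpredD ?rpredZ // scalerDr scalerDl scalerA addrACA.
move=> y; rewrite /gens /= in_cons => /orP[/eqP->|ys]; apply/asboolP.
  by exists 1, 0; rewrite rpred0 scale1r addr0.
by exists 0, y; rewrite scale0r add0r mspan_gen.
Qed.

Lemma gens_sub s G : (forall x, x \in s -> x \in mspan G) ->
  {subset mspan (gens s) <= mspan G}.
Proof. by move=> h; apply: mspan_min => //; exact: mspan_submod. Qed.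

Lemma gens_sum s x : x \in mspan (gens s) ->
  exists c : 'I_(size s) -> S, x = \sum_i c i *: s`_i.
Proof.
elim: s x => [|v s IH] x.
  by move/gens_nil->; exists (fun=> 0); rewrite big_ord0.
move/gens_cons=> [a [y [/IH[c ->] ->]]].
exists (fun i : 'I_(size s).+1 => oapp c a (unlift ord0 i)).
rewrite big_ord_recl unlift_none /=; congr (_ + _).
by apply: eq_bigr => i _; rewrite liftK.
Qed.

Lemma sum_gens s (c : 'I_(size s) -> S) :
  \sum_i c i *: s`_i \in mspan (gens s).
Proof.
by rewrite rpred_sum // => i _; rewrite rpredZ // mspan_gen //; exact: mem_nth.
Qed.

Lemma fingenP : fingen V <-> exists s, forall x, x \in mspan (gens s).
Proof.
split=> -[s h]; exists s => x; first by have [c ->] := h x; exact: sum_gens.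
exact: gens_sum.
Qed.

Definition sub_fg I : Prop :=
  exists s, (forall x, x \in s -> x \in I) /\ {subset I <= mspan (gens s)}.

(** Ascending chains for [b = true] and descending ones for [b = false] are
    treated at once, because both chain conditions pass to finitely generated
    modules by the same comparison of two nested submodules. *)
Definition mono (b : bool) (I : nat -> {pred V}) : Prop :=
  forall n, if b then {subset I n <= I n.+1} else {subset I n.+1 <= I n}.

Definition stab (I : nat -> {pred V}) : Prop :=
  exists n, forall m, (n <= m)%N -> I m =i I n.

Definition chain_cond (b : bool) : Prop :=
  forall I : nat -> {pred V}, (forall n, submod_closed (I n)) -> mono b I ->
    stab I.

Lemma mono_le b (I : nat -> {pred V}) m n : mono b I -> (m <= n)%N ->
  if b then {subset I m <= I n} else {subset I n <= I m}.
Proof.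
move=> mI /subnKC<-; elim: (n - m)%N => [|k IH]; first by rewrite addn0; case:
  b {mI}.
rewrite addnS; have := mI (m + k)%N; case: b {mI} IH => h1 h2 x hx.
  by apply/h2/h1.
by apply/h1/h2.
Qed.

End Span.

Lemma dependent_choice (T : Type) (r : T -> T -> Prop) (t0 : T) :
  (forall t, exists u, r t u) -> exists f : nat -> T, f 0%N = t0 /\ forall n,
    r (f n) (f n.+1).
Proof.
move=> h; have [g hg] := choice h.
by exists (fun n => iter n g t0); split=> // n; exact: hg.
Qed.

(** Choosing smaller and smaller members of a family without minimal member
    would give a strictly descending chain. *)
Lemma cc_min (S : nzRingType) (V : lmodType S) (Q : {pred V} -> Prop) :
  chain_cond V false -> (forall I, Q I -> submod_closed I) -> (exists I, Q I) ->
  exists I, Q I /\ forall J, Q J -> {subset J <= I} -> {subset I <= J}.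
Proof.
move=> dV Qc [I0 QI0]; apply: contrapT => nmin.
pose T := {I | Q I}.
have step (t : T) : exists u : T, {subset sval u <= sval t} /\
  ~ {subset sval t <= sval u}.
  case: t => I QI /=; apply: contrapT => h; apply: nmin; exists I; split=>
    // J QJ JI.
  by apply: contrapT => nIJ; apply: h; exists (exist _ J QJ).
have [f [_ hf]] := dependent_choice (exist _ I0 QI0 : T) step.
have [|n|n hn] := dV (fun n => sval (f n)).
- by move=> n; apply/Qc; case: (f n).
- by case: (hf n).
by case: (hf n) => _; apply=> x; rewrite hn.
Qed.

(** Otherwise one can forever adjoin elements outside the span of the previous
    ones. *)
Lemma acc_fg (S : nzRingType) (V : lmodType S) (I : {pred V}) :
  chain_cond V true -> submod_closed I -> sub_fg I.
Proof.
move=> aV cI; apply: contrapT => nfg.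
pose T := {s : seq V | forall x, x \in s -> x \in I}.
have step (t : T) : exists u : T, exists2 x, x \in I /\
  x \notin mspan (gens (sval t)) & sval u = x :: sval t.
  case: t => s sI /=; apply: contrapT => h; apply: nfg; exists s; split=>
    // x Ix.
  apply: contrapT => /negP nx; apply: h.
  have xsI y : y \in x :: s -> y \in I.
    by rewrite in_cons => /orP[/eqP->|/sI].
  by exists (exist _ _ xsI), x.
have t0 : T by exists [::].
have [f [_ hf]] := dependent_choice t0 step.
have [|n|n hn] := aV (fun n => mspan (gens (sval (f n)))).
- by move=> n; exact: mspan_submod.
- apply: gens_sub => x xf; apply: mspan_gen; rewrite /gens /=.
  by case: (hf n) => y _ ->; rewrite in_cons xf orbT.
case: (hf n) => x [Ix /negP nx] e; apply: nx; rewrite -(hn n.+1) //.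
by apply: mspan_gen; rewrite /gens /= e mem_head.
Qed.

Lemma acc_of_fg (S : nzRingType) (V : lmodType S) :
  (forall I : {pred V}, submod_closed I -> sub_fg I) -> chain_cond V true.
Proof.
move=> fgV I cI mI.
have le m n : (m <= n)%N -> {subset I m <= I n} by exact: (@mono_le _ _ true).
pose U : {pred V} := fun x => `[< exists n, x \in I n >].
have cU : submod_closed U.
  split; first by apply/asboolP; exists 0%N; apply: submod0.
  move=> a x y /asboolP[n hx] /asboolP[m hy]; apply/asboolP; exists (maxn n m).
  by rewrite submodD ?submodZ //; [apply: le hx|apply: le hy];
    rewrite ?leq_maxl ?leq_maxr.
have [s [sU Us]] := fgV _ cU.
have {sU} [n hn] : exists n, forall x, x \in s -> x \in I n.
  elim: s sU {Us} => [|v s IH] sU; first by exists 0%N.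
  have [|n hn] := IH; first by move=> x xs; apply: sU; rewrite in_cons xs orbT.
  have /asboolP[m hm] := sU v (mem_head _ _).
  exists (maxn n m) => x; rewrite in_cons => /orP[/eqP->|/hn].
    by apply: le hm; exact: leq_maxr.
  by apply: le; exact: leq_maxl.
exists n => m nm x; apply/idP/idP => hx; last exact: le hx.
apply: (@mspan_min _ _ (gens s)) => //; apply: Us.
by apply/asboolP; exists m.
Qed.

(** Two nested submodules of the span of [v :: s] agree as soon as they have the
    same trace on the span of [s] and the same leading coefficients at [v]. *)
Lemma cc_gens (S : nzRingType) (V : lmodType S) b (s : seq V)
  (I : nat -> {pred V}) :
  chain_cond S^o b -> (forall n, submod_closed (I n)) -> mono b I ->
  (forall n, {subset I n <= mspan (gens s)}) -> stab I.
Proof.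
move=> cS; elim: s I => [|v s IH] I cI mI sI.
  exists 0%N => m _ x; apply/idP/idP => /sI/gens_nil->; exact: submod0.
pose I' n := predI_submod (I n) (mspan (gens s)).
pose L n : {pred S^o} := fun a =>
  `[< exists y, y \in mspan (gens s) /\ a *: v + y \in I n >].
have [||n|n1 h1] := IH I'.
- by move=> n; apply: setI_submod => //; exact: mspan_submod.
- move=> n; have := mI n; case: (b) => h x; rewrite !in_predI_submod =>
  /andP[/h-> ->] //.
- by move=> x; rewrite in_predI_submod => /andP[].
have [||n2 h2] := cS L.
- move=> n; split; first by apply/asboolP; exists 0;
  rewrite scale0r addr0 rpred0 submod0.
  move=> a x y /asboolP[p [sp Ip]] /asboolP[q [sq Iq]]; apply/asboolP.
  exists (a *: p + q); rewrite rpredD ?rpredZ //; split=> //.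
  rewrite scalerDl -scalerA addrACA -scalerDr submodD ?submodZ //.
- move=> n; have := mI n; case: (b) => h x /asboolP[y [sy Iy]]; apply/asboolP;
  by exists y; split=> //; apply: h.
have key m n : I' m =i I' n -> L m =i L n -> {subset I n <= I m} ->
  {subset I m <= I n}.
  move=> eI eL nm z mz; have [a [y [sy ez]]] := gens_cons (sI _ _ mz).
  have : a \in L m by apply/asboolP; exists y; rewrite -ez.
  rewrite eL => /asboolP[y' [sy' Iy']].
  have : z - (a *: v + y') \in I' m.
    have mz' := nm _ Iy'.
    rewrite in_predI_submod submodB //=.
    by rewrite ez opprD addrACA subrr add0r rpredB.
  rewrite eI in_predI_submod => /andP[+ _] => /submodD; move=>
    /(_ _ (cI n) Iy').
  by rewrite subrK.
exists (maxn n1 n2) => m le_m.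
have eI : I' m =i I' (maxn n1 n2).
  by move=> x; rewrite h1 ?h1 ?leq_maxl // (leq_trans _ le_m) // leq_maxl.
have eL : L m =i L (maxn n1 n2).
  by move=> x; rewrite h2 ?h2 ?leq_maxr // (leq_trans _ le_m) // leq_maxr.
have := mono_le mI le_m; case: (b) => h x; apply/idP/idP; try exact: h;
  by apply: key => // y; rewrite ?eI ?eL.
Qed.

Lemma cc_fingen (S : nzRingType) (V : lmodType S) b :
  chain_cond S^o b -> fingen V -> chain_cond V b.
Proof. by move=> cS /fingenP[s hs] I cI mI; apply: (@cc_gens _ _ b s) =>
  // n x _. Qed.

(** * Commutative artinian rings are noetherian *)

(** Otherwise take a minimal ideal [I] among those that are not finitely
    generated. For every [r] one of [r I] and the annihilator of [r] in [I] is
    not finitely generated either, so [r I = I] or [r I = 0]; as the powers of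
    [r] stabilise, [r] acts invertibly in the first case. So [I] is a vector
    space; by Zorn it is the sum of a line and a proper submodule, which is
    finitely generated, and so is [I]. *)
Lemma artinian_acc (R : comNzRingType) : artinian R -> chain_cond R^o true.
Proof.
move=> aR; apply: acc_of_fg => I0 cI0; apply: contrapT => nI0.
have [I [[cI nI] minI]] : exists I : {pred R^o},
  (submod_closed I /\ ~ sub_fg I) /\
    forall J : {pred R^o}, submod_closed J /\ ~ sub_fg J ->
      {subset J <= I} -> {subset I <= J}.
  have dR : chain_cond R^o false by move=> I cI mI; exact: aR.
  by apply: (cc_min dR) => [I []|]; last exists I0.
have small (J : {pred R^o}) : submod_closed J -> {subset J <= I} ->
  (exists2 x, x \in I & x \notin J) ->
    sub_fg J.
  move=> cJ JI [x Ix /negP nJx]; apply: contrapT => nJ; apply: nJx.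
  exact: minI Ix.
have dich (r : R) : (forall x, x \in I -> exists2 y, y \in I & x = r * y) \/
    (forall x, x \in I -> r * x = 0).
  pose rI : {pred R^o} := fun x => `[< exists2 y, y \in I & x = r * y >].
  pose an : {pred R^o} := predI_submod I [pred x | r * x == 0].
  have crI : submod_closed rI.
    split; first by apply/asboolP; exists 0; rewrite ?mulr0 // submod0.
    move=> a x y /asboolP[x' Ix' ->] /asboolP[y' Iy' ->]; apply/asboolP.
    exists (a *: x' + y'); first by rewrite submodD ?submodZ.
    by rewrite mulrDr; congr (_ + _); exact: mulrCA.
  have can : submod_closed an.
    apply: setI_submod => //; split; first by rewrite inE mulr0.
    move=> a x y; rewrite !inE mulrDr => /eqP rx /eqP->.
    by rewrite addr0 -[_ *: x]/(a * x) mulrCA rx mulr0.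
  have [h|n1] := EM (forall x, x \in I -> x \in rI).
    by left=> x /h/asboolP.
  have [h|n2] := EM (forall x, x \in I -> x \in an).
    by right=> x /h; rewrite in_predI_submod => /andP[_ /eqP].
  have notall (J : {pred R^o}) : ~ (forall x, x \in I -> x \in J) -> exists2 x,
    x \in I & x \notin J.
    move=> h; apply: contrapT => h'; apply: h => x Ix; apply: contrapT =>
      /negP nJ.
    by apply: h'; exists x.
  have [|s1 [s1I s1P]] := small _ crI _ (notall _ n1).
    by move=> x /asboolP[y Iy ->]; apply: (submodZ r cI Iy).
  have [|s2 [s2I s2P]] := small _ can _ (notall _ n2).
    by move=> x; rewrite in_predI_submod => /andP[].
  exfalso; apply: nI.
  have [f hf] : exists f : R -> R, forall x, x \in s1 -> f x \in I /\
    x = r * f x.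
    have /choice[f hf] : forall x, exists y, x \in s1 -> y \in I /\ x = r * y.
      move=> x; have [/s1I/asboolP[y Iy ->]|_] := boolP (x \in s1);
        last by exists 0.
      by exists y.
    by exists f => x; exact: hf.
  exists (map f s1 ++ s2); split.
    move=> x; rewrite mem_cat => /orP[/mapP[y /hf[Iy _] ->] //|/s2I].
    by rewrite in_predI_submod => /andP[].
  move=> x Ix.
  have : r * x \in mspan (@gens R R^o s1) by apply: s1P; apply/asboolP;
    exists x.
  have lift (y : R) : y \in mspan (@gens R R^o s1) ->
      exists2 z : R, z \in mspan (@gens R R^o (map f s1)) & z \in I /\
        y = r * z.
    move=> hy; apply/asboolP; move: y hy.
    apply: (@mspan_min _ R^o _ (fun y =>
      `[< exists2 z : R, z \in mspan (@gens R R^o (map f s1)) & z \in I /\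
      y = r * z >])).
      split.
        apply/asboolP; exists 0; first exact: (rpred0 (mspan (@gens R R^o _))).
        by split; [exact: (submod0 cI) | rewrite mulr0].
      move=> a y y' /asboolP[z sz [Iz ->]] /asboolP[z' sz' [Iz' ->]].
      apply/asboolP; exists (a *: (z : R^o) + z').
        by apply: (submodD (mspan_submod _)) => //;
          apply: (submodZ _ (mspan_submod _)).
      split; first exact: (submodD cI (submodZ a cI Iz) Iz').
      by rewrite mulrDr; congr (_ + _); exact: mulrCA.
    move=> y ys; apply/asboolP; have [Ify e] := hf _ ys; exists (f y) => //.
    by apply: mspan_gen; rewrite /gens /= map_f.
  case/lift => z sz [Iz e].
  have /s2P xz : x - z \in an.
    rewrite in_predI_submod submodB //=; apply/eqP.
    by rewrite mulrBr e subrr.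
  rewrite -[x](subrK z) rpredD //.
    apply: gens_sub xz => y ys; apply: mspan_gen.
    by rewrite /gens /= mem_cat ys orbT.
  apply: gens_sub sz => y ys; apply: mspan_gen.
  by rewrite /gens /= mem_cat ys.
(* [r] has an inverse on [I]: in [R] the chain of the ideals [(r ^+ n)]
   stabilises. *)
have inv (r : R) : ~ (forall x, x \in I -> r * x = 0) ->
    exists s : R, forall x, x \in I -> x = r * (s * x).
  move=> nr; have [rI|//] := dich r.
  pose P n : {pred R^o} := fun x => `[< exists y, x = r ^+ n * y >].
  have [||n hn] := aR P.
  - move=> n; split; first by apply/asboolP; exists 0; rewrite mulr0.
    move=> a x y /asboolP[x' ->] /asboolP[y' ->]; apply/asboolP.
    exists (a * x' + y'); rewrite mulrDr; congr (_ + _).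
    exact: mulrCA.
  - by move=> n x /asboolP[y ->]; apply/asboolP; exists (r * y);
    rewrite mulrA exprSr.
  have : (r ^+ n : R) \in P n.+1 by rewrite hn //; apply/asboolP; exists 1;
    rewrite mulr1.
  move=> /asboolP[s es]; exists s => x Ix.
  have {Ix} [y ->] : exists y, x = r ^+ n * y.
    clear -rI Ix; elim: n x Ix => [|n IH] x Ix; first by exists x;
      rewrite mul1r.
    by have [z /IH[w ->] ->] := rI _ Ix; exists w; rewrite mulrA exprS.
  by rewrite {1}es exprS !mulrA; congr (_ * _); rewrite mulrAC.
have [x0 Ix0 nx0] : exists2 x, x \in I & x != 0.
  apply: contrapT => h; apply: nI; exists [::]; split=> // x Ix.
  have -> : x = 0; last by rewrite rpred0.
  by apply/eqP; apply: contrapT => /negP nx; apply: h; exists x.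
(* Membership of 0 is not required, so that the empty chain has a bound. *)
pose P : set (set R) := [set H | [/\ forall x, H x -> x \in I,
  forall a x y, H x -> H y -> H (a * x + y) & ~ H x0]].
have [|H [[HI Hc Hx0] Hmax]] := @Zorn_bigcup R P.
  move=> F FP Ft; split.
  - by move=> x [H /FP[h _ _] /h].
  - move=> a x y [H1 F1 h1] [H2 F2 h2].
    have [h|h] := Ft _ _ F1 F2.
      by exists H2 => //; have [_ c _] := FP _ F2; apply: c => //; exact: h.
    by exists H1 => //; have [_ c _] := FP _ F1; apply: c => //; exact: h.
  - by case=> H /FP[_ _ h] /h.
(* If 0 were missing, [H] would be empty and could be enlarged by 0. *)
have H0 : H 0.
  apply: contrapT => nH0; apply: (Hmax (H `|` [set 0])).
    split; first by move=> x; left.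
    by move=> /(_ 0); apply: contra_not nH0; apply; right.
  split.
  - by move=> x [/HI//|->]; exact: submod0.
  - have nz x : ~ H x.
      by move=> hx; apply: nH0; have := Hc (-1) _ _ hx hx; rewrite mulN1r addNr.
    by move=> a x y [/nz//|->] [/nz//|->]; right; rewrite /= mulr0 addr0.
  - by case=> [//|/= x00]; rewrite x00 eqxx in nx0.
pose Hp : {pred R^o} := fun x => `[< H x >].
have cHp : submod_closed Hp.
  by split=> [|a x y /asboolP hx /asboolP hy]; apply/asboolP => //; exact: Hc.
have [||s [sH Hs]] := small _ cHp; first by move=> x /asboolP/HI.
  by exists x0 => //; apply/asboolP.
apply: nI; exists (x0 :: s); split.
  by move=> x; rewrite in_cons => /orP[/eqP->//|/sH/asboolP/HI].
have sub (h : R) : H h -> h \in mspan (@gens R R^o (x0 :: s)).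
  move=> Hh; have : (h : R^o) \in Hp by apply/asboolP.
  move/Hs; apply: gens_sub => y ys; apply: mspan_gen.
  by rewrite /gens /= in_cons ys orbT.
move=> y Iy; have [/sub//|nHy] := EM (H y).
have [h [r [Hh e]]] : exists h r, H h /\ x0 = h + r * y.
  apply: contrapT => nex.
  apply: (Hmax [set x | exists h r, H h /\ x = h + r * y]).
    split; first by move=> x Hx; exists x, 0; rewrite mul0r addr0.
    by move=> /(_ y); apply: contra_not nHy; apply; exists 0, 1;
      rewrite add0r mul1r.
  split=> //.
  - move=> x [h [r [/HI Ih ->]]]; rewrite (submodD cI) //.
    exact: (submodZ r cI Iy).
  - move=> a x x' [h [r [Hh ->]]] [h' [r' [Hh' ->]]].
    exists (a * h + h'), (a * r + r'); split; first exact: Hc.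
    by rewrite mulrDr mulrDl mulrA addrACA.
have [|s' hs'] := inv r.
  move=> /(_ _ Iy) ry; apply: Hx0; rewrite e ry addr0; exact: Hh.
have -> : y = s' *: (x0 : R^o) - s' *: (h : R^o).
  by rewrite -scalerBr e [h + _]addrC addrK -[RHS]/(s' * _) mulrCA; exact: hs'.
apply: (submodB (mspan_submod _)); apply: (submodZ _ (mspan_submod _)).
  by apply: mspan_gen; rewrite /gens /= mem_head.
exact: sub.
Qed.

Lemma artinian_cc (R : comNzRingType) b : artinian R -> chain_cond R^o b.
Proof. by case: b => h; [exact: artinian_acc|move=> I cI mI; exact: h]. Qed.

(** Submodules over [A] are in particular [R]-submodules, and [A] is a finitely
    generated [R]-module. *)
Lemma artin_algebra_cc (R : comNzRingType) (A : algType R) b :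
  artin_algebra A -> chain_cond (A^o : lmodType A) b.
Proof.
move=> [aR fA]; have h := cc_fingen (@artinian_cc R b aR) fA.
move=> I cI mI; apply: h mI => n; split; first exact: (submod0 (cI n)).
move=> a x y Ix Iy; apply: (submodD (cI n) _ Iy).
have -> : a *: x = (a%:A : A) *:
  (x : A^o) by rewrite -[RHS]/(_ * _) -scalerAl mul1r.
exact: (submodZ _ (cI n) Ix).
Qed.

(** The least positive element of the union of the chain generates every ideal
    of the chain that contains it. *)
Lemma int_acc : chain_cond (int^o : lmodType int) true.
Proof.
move=> I cI mI.
have le m n : (m <= n)%N -> {subset I m <= I n} by exact: (@mono_le _ _ true).
have [h|] := EM (exists n d, (0 < d)%N /\ (d%:Z : int) \in I n); last first.
  move=> h; exists 0%N => m _.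
  have z n x : x \in I n -> x = 0.
    move=> Ix; apply: contrapT => nx; apply: h; exists n, `|x|%N;
      rewrite absz_gt0.
    split; first exact/eqP.
    case: x Ix nx => k Ik nk //.
    rewrite -[Posz _]mulr1 -[_ * _]/((`|Negz k|%:Z : int) *: (1 : int^o)).
    rewrite NegzE in Ik *; rewrite abszN /=.
    by have := submodZ (-1) (cI n) Ik;
      rewrite scaleN1r opprK -[_ *: _]/(_ * _) mulr1.
  by move=> x; apply/idP/idP => /z->; exact: (submod0 (cI _)).
have {}h : exists d, `[< (0 < d)%N /\ exists n, (d%:Z : int) \in I n >].
  by case: h => n [d [d0 Id]]; exists d; apply/asboolP; split=> //; exists n.
case: (ex_minnP h) => d /asboolP[d0 [n Idn]] dmin; exists n => m nm x.
apply/idP/idP; last exact: le.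
move=> Ix; have Idm := le _ _ nm _ Idn.
have e := divz_eq x d; rewrite e.
have : (x %% d)%Z \in I m.
  have -> : (x %% d)%Z = x - (x %/ d)%Z * d by rewrite {2}e addrAC subrr add0r.
  exact: (submodB (cI m) Ix (submodZ _ (cI m) Idm)).
have : (`|(x %% d)%Z| < d)%N by rewrite -ltz_nat gez0_abs ?modz_ge0 ?ltz_pmod
  //; case: (d) d0.
have : (0 <= (x %% d)%Z) by rewrite modz_ge0 //; case: (d) d0.
case: (x %% d)%Z => // r _ rd Ir.
have [->|r0] := posnP r; first by rewrite addr0; exact: (submodZ _ (cI n) Idn).
have : (d <= r)%N by apply: dmin; apply/asboolP; split=> //; exists m.
by rewrite leqNgt rd.
Qed.

(** * Isomorphisms, direct sums and submodules *)

Section Linear.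
Variable S : nzRingType.
Implicit Types U V W X Y : lmodType S.

Definition lin U V (f : U -> V) (Hf : linear f) : {linear U -> V} :=
  HB.pack f (GRing.isLinear.Build S U V *:%R f Hf).

Fact lpair_linear U V W (f : {linear U -> V}) (g : {linear U -> W}) :
  linear (fun x => (f x, g x)).
Proof. by move=> a x y; rewrite !linearP. Qed.
Definition lpair U V W (f : {linear U -> V}) (g : {linear U -> W}) :
  {linear U -> (V * W)%type} := lin (lpair_linear f g).

Fact lcopair_linear U V W (f : {linear U -> W}) (g : {linear V -> W}) :
  linear (fun x : U * V => f x.1 + g x.2).
Proof. by move=> a x y; rewrite /= !linearP scalerDr addrACA. Qed.
Definition lcopair U V W (f : {linear U -> W}) (g : {linear V -> W}) :
  {linear (U * V)%type -> W} := lin (lcopair_linear f g).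

Lemma linv U V (f : {linear U -> V}) : bijective f ->
  exists g : {linear V -> U}, cancel f g /\ cancel g f.
Proof.
case=> g fK gK; have lg : linear g.
  by move=> a x y; apply: (can_inj fK); rewrite linearP !gK.
by exists (lin lg).
Qed.

Lemma misoE U V : miso U V ->
  exists (f : {linear U -> V}) (g : {linear V -> U}), cancel f g /\ cancel g f.
Proof. by case=> f /linv[g ?]; exists f, g. Qed.

Lemma miso_can U V (f : {linear U -> V}) (g : {linear V -> U}) :
  cancel f g -> cancel g f -> miso U V.
Proof. by move=> fK gK; exists f, g. Qed.

Lemma miso_refl U : miso U U. Proof. by exists idfun, id. Qed.

Lemma miso_sym U V : miso U V -> miso V U.
Proof. by case/misoE => f [g [fK gK]]; exact: (miso_can gK fK). Qed.

Lemma miso_trans V U W : miso U V -> miso V W -> miso U W.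
Proof. by case=> f bf [g bg]; exists (g \o f); exact: bij_comp. Qed.

Lemma miso_inj_surj U V (f : {linear U -> V}) : injective f -> surj f ->
  miso U V.
Proof.
move=> fI fS; exists f; have [g hg] := choice fS.
by exists g => // x; apply: fI; rewrite hg.
Qed.

Lemma lin_inj U V (f : {linear U -> V}) : (forall x, f x = 0 -> x = 0) ->
  injective f.
Proof.
move=> h x y e; apply/eqP; rewrite -subr_eq0; apply/eqP/h.
by rewrite linearB e subrr.
Qed.

Lemma miso_prod U V X Y : miso U X -> miso V Y ->
  miso (U * V)%type (X * Y)%type.
Proof.
move=> /misoE[f [f' [fK fK']]] /misoE[g [g' [gK gK']]].
apply: (@miso_can _ _ (lpair (f \o fst) (g \o snd))
  (lpair (f' \o fst) (g' \o snd))).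
  by case=> x y /=; rewrite fK gK.
by case=> x y /=; rewrite fK' gK'.
Qed.

Lemma miso_prodC U V : miso (U * V)%type (V * U)%type.
Proof. by apply: (@miso_can _ _ (lpair snd fst) (lpair snd fst)); case. Qed.

Lemma miso_prodA U V W : miso (U * (V * W))%type ((U * V) * W)%type.
Proof.
apply: (@miso_can _ _ (lpair (lpair fst (fst \o snd)) (snd \o snd))
  (lpair (fst \o fst) (lpair (snd \o fst) snd))).
  by case=> x [].
by case=> [[]].
Qed.

Lemma miso_prodCA U V W : miso (U * (V * W))%type (V * (U * W))%type.
Proof.
apply: miso_trans (miso_prodA _ _ _) _.
apply: miso_trans (miso_sym (miso_prodA _ _ _)).
exact: (miso_prod (miso_prodC _ _) (miso_refl _)).
Qed.

Lemma miso_prod0 U V : is_zero V -> miso (U * V)%type U.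
Proof.
move=> V0; apply: (@miso_can _ _ fst (lpair idfun \0)) => //.
by case=> x y /=; rewrite (V0 y).
Qed.

Lemma miso_0prod U V : is_zero U -> miso (U * V)%type V.
Proof. by move=> U0; apply: miso_trans (miso_prodC _ _) (miso_prod0 _ U0). Qed.

Lemma zero_rV : is_zero 'rV[S]_0.
Proof. by move=> x; apply/rowP; case. Qed.

Lemma miso_zero U V : miso U V -> is_zero U -> is_zero V.
Proof. by case/misoE => f [g [_ gK]] U0 y; rewrite -(gK y)
  (U0 (g y)) linear0. Qed.

Lemma is_zero_miso U V : is_zero U -> is_zero V -> miso U V.
Proof.
by move=> U0 V0; apply: (@miso_can _ _ \0 \0) => x; rewrite /= ?(U0 x) ?(V0 x).
Qed.

Lemma retract_miso U X (u : {linear U -> X}) (v : {linear X -> U}) :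
  bijective (v \o u) -> miso (U * mker v)%type X.
Proof.
move=> /linv[w [wK Kw]].
apply: (@miso_inj_surj _ _ (lcopair u (mker_val (f := v)))).
  apply: lin_inj => -[x [k vk]] /= e; have /eqP vk0 : v k == 0 by exact: vk.
  have x0 : x = 0.
    rewrite -[x]wK /= -(linear0 w); congr (w _).
    by have := congr1 v e; rewrite linearD linear0 vk0 addr0.
  by congr (_, _) => //; apply: val_inj; move: e; rewrite /= x0 linear0 add0r.
move=> x; pose y := w (v x).
have hk : x - u y \in ker_pred v.
  by rewrite unfold_in linearB -[v (u y)]/((v \o u) y) Kw subrr.
by exists (y, MKer hk); rewrite /= addrC subrK.
Qed.

Lemma summand_retract U X (u : {linear U -> X}) (v : {linear X -> U}) :
  bijective (v \o u) -> summand U X.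
Proof. by move=> /retract_miso h; exists (mker v). Qed.

Lemma summandE U X : summand U X ->
  exists (u : {linear U -> X}) (v : {linear X -> U}), cancel u v.
Proof.
case=> T /misoE[f [g [fK gK]]]; exists (f \o lpair idfun \0), (fst \o g) =>
  x /=.
by rewrite fK.
Qed.

Lemma summand_trans V U W : summand U V -> summand V W -> summand U W.
Proof.
move=> /summandE[u [v uK]] /summandE[u' [v' uK']].
apply: (@summand_retract _ _ (u' \o u) (v \o v')).
by exists id => x /=; rewrite uK' uK.
Qed.

Lemma miso_summand U V : miso U V -> summand U V.
Proof. by case/misoE => f [g [fK _]]; apply: (@summand_retract _ _ f g);
  exists id. Qed.

Lemma summandl U V : summand U (U * V)%type.
Proof. by exists V; exact: miso_refl. Qed.

Lemma summandr U V : summand V (U * V)%type.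
Proof. by exists U; exact: miso_prodC. Qed.

Lemma indec_miso U V : miso U V -> indecomposable U -> indecomposable V.
Proof.
move=> UV [nU hU]; split; first by move=> V0;
  apply/nU/(miso_zero (miso_sym UV)).
by move=> X Y h; apply: hU; exact: miso_trans UV h.
Qed.

Lemma summand_indec U V : ~ is_zero U -> indecomposable V -> summand U V ->
  miso U V.
Proof.
move=> nU [_ hV] [T h]; have [//|T0] := hV _ _ (miso_sym h).
exact: miso_trans (miso_sym (miso_prod0 _ T0)) h.
Qed.

(** ** Submodules as modules *)

Lemma mker_eq0 U V (f : {linear U -> V}) (k : mker f) : f (mker_val k) = 0.
Proof. by have /eqP := mkerP k. Qed.

Lemma mker_valI U V (f : {linear U -> V}) : injective (mker_val (f := f)).
Proof. exact: val_inj. Qed.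

Lemma mkerE U V (f : {linear U -> V}) x : f x = 0 -> exists k : mker f,
  mker_val k = x.
Proof. by move=> /eqP h; exists (MKer (h : x \in ker_pred f)). Qed.

Lemma mspan_pred V (I : {pred V}) x : submod_closed I ->
  (x \in mspan [set y | y \in I]) = (x \in I).
Proof.
move=> cI; apply/idP/idP => h; last exact: mspan_gen.
exact: (mspan_min cI _ h).
Qed.

Definition image_pred U V (f : {linear U -> V}) : {pred V} := fun y =>
  `[< exists x, f x = y >].

Lemma image_submod U V (f : {linear U -> V}) : submod_closed (image_pred f).
Proof.
split; first by apply/asboolP; exists 0; rewrite linear0.
move=> a x y /asboolP[x' <-] /asboolP[y' <-]; apply/asboolP.
by exists (a *: x' + y'); rewrite linearP.
Qed.

Lemma image_predP U V (f : {linear U -> V}) y :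
  y \in mspan [set f x | x in setT] <-> exists x, f x = y.
Proof.
split=> [h|[x <-]]; last by apply: mspan_gen; exists x.
apply/asboolP; apply: (mspan_min (image_submod f) _ h) => z [x _ <-].
by apply/asboolP; exists x.
Qed.

(** A kernel already carries a module structure, which this encoding of the
    submodule generated by [G] reuses. *)
Definition subm V (G : set V) : lmodType S := mker (mproj G).

Definition subm_val V (G : set V) : {linear subm G -> V} :=
  mker_val (f := mproj G).

Lemma submP V (G : set V) (x : subm G) : subm_val G x \in mspan G.
Proof. by have /eqP := mkerP x; rewrite -(linear0 (mproj G)) => /mprojP;
  rewrite subr0. Qed.

Lemma submE V (G : set V) x : x \in mspan G -> exists y, subm_val G y = x.
Proof. by move=> h; apply: mkerE; rewrite -(linear0 (mproj G)); apply/mprojP;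
  rewrite subr0. Qed.

Lemma subm_valI V (G : set V) : injective (subm_val G).
Proof. exact: mker_valI. Qed.

Definition full_pred V : {pred V} := fun=> true.

Lemma full_submod V : submod_closed (@full_pred V). Proof. by []. Qed.

Lemma full_miso V : miso (subm [set x | x \in @full_pred V]) V.
Proof.
apply: (@miso_inj_surj _ _ (subm_val _)); first exact: subm_valI.
by move=> x; apply: submE; exact: mspan_gen.
Qed.

Lemma lift_inj U V W (f : {linear U -> W}) (g : {linear V -> W}) :
  injective g -> (forall x, exists y, g y = f x) ->
  exists h : {linear U -> V}, forall x, g (h x) = f x.
Proof.
move=> gI /choice[h hh]; have lh : linear h.
  by move=> a x y; apply: gI; rewrite linearP !hh linearP.
by exists (lin lh).
Qed.

Lemma miso_image U V W (f : {linear U -> W}) (g : {linear V -> W}) :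
  injective f -> injective g ->
    (forall x, (exists y, f y = x) <-> (exists y, g y = x)) ->
  miso U V.
Proof.
move=> fI gI fg.
have [h hh] : exists h : {linear U -> V}, forall x, g (h x) = f x.
  by apply: lift_inj => // x; apply/fg; exists x.
apply: (@miso_inj_surj _ _ h) => [x y e|y]; first by apply: fI; rewrite -!hh e.
have [x e] : exists x, f x = g y by apply/fg; exists y.
by exists x; apply: gI; rewrite hh.
Qed.

Lemma mquot_miso U V (f : {linear U -> V}) :
  surj f -> miso (mquot [set x | f x = 0]) V.
Proof.
move=> fS; pose g := mquot_lift (G := [set x | f x = 0])
  (fun x (h : f x = 0) => h).
apply: (@miso_inj_surj _ _ g).
  apply: lin_inj => u; rewrite -(mproj_repr u) /g /= mquot_liftE => h.
  by rewrite -(linear0 (mproj _)); apply/mprojP; rewrite subr0;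
    exact: mspan_gen.
by move=> y; have [x <-] := fS y; exists (mproj _ x); rewrite /g /= mquot_liftE.
Qed.

End Linear.

(** * Finitely generated modules *)

Section FinGen.
Variable S : nzRingType.
Implicit Types U V W X Y : lmodType S.

Lemma mspan_map U V (f : {linear U -> V}) s x :
  x \in mspan (gens s) -> f x \in mspan (gens (map f s)).
Proof.
pose I : {pred U} := fun x => f x \in mspan (gens (map f s)).
have cI : submod_closed I.
  split; first by rewrite unfold_in linear0 rpred0.
  by move=> a y z hy hz; rewrite unfold_in linearP rpredD // rpredZ.
by apply: (mspan_min cI) => y ys; apply: mspan_gen; rewrite /gens /= map_f.
Qed.

Lemma fingen_surj U V (f : {linear U -> V}) : surj f -> fingen U -> fingen V.
Proof.
move=> fS /fingenP[s hs]; apply/fingenP; exists (map f s) => y.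
by have [x <-] := fS y; exact: mspan_map.
Qed.

Lemma fingen_summand U V : summand U V -> fingen V -> fingen U.
Proof.
case/summandE => u [v uK]; apply: (@fingen_surj _ _ v) => y.
by exists (u y).
Qed.

Lemma fingen_prod U V : fingen U -> fingen V -> fingen (U * V)%type.
Proof.
move=> /fingenP[s hs] /fingenP[t ht]; apply/fingenP.
pose i1 : {linear U -> (U * V)%type} := lpair idfun \0.
pose i2 : {linear V -> (U * V)%type} := lpair \0 idfun.
exists (map i1 s ++ map i2 t) => -[x y].
have -> : (x, y) = i1 x + i2 y by rewrite /i1 /i2 /=; congr (_, _);
  rewrite /= ?addr0 ?add0r.
apply: rpredD.
  apply: gens_sub (mspan_map i1 (hs x)) => z zs; apply: mspan_gen.
  by rewrite /gens /= mem_cat zs.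
apply: gens_sub (mspan_map i2 (ht y)) => z zs; apply: mspan_gen.
by rewrite /gens /= mem_cat zs orbT.
Qed.

Lemma fingen_rV n : fingen 'rV[S]_n.
Proof.
apply/fingenP; exists [seq delta_mx 0 j | j <- enum 'I_n] => x.
rewrite [x]row_sum_delta rpred_sum // => j _; rewrite rpredZ //.
by apply: mspan_gen; apply: map_f; rewrite mem_enum.
Qed.

Fact rcomb_linear n V (s : 'I_n -> V) :
  linear (fun v : 'rV[S]_n => \sum_i v 0 i *: s i).
Proof.
move=> a x y; rewrite scaler_sumr -big_split /=; apply: eq_bigr => i _.
by rewrite !mxE scalerDl scalerA.
Qed.
Definition rcomb n V (s : 'I_n -> V) : {linear 'rV[S]_n -> V} :=
  lin (rcomb_linear s).

Lemma rcombE n V (s : 'I_n -> V) v : rcomb s v = \sum_i v 0 i *: s i.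
Proof. by []. Qed.

Lemma rcomb_delta n V (s : 'I_n -> V) i : rcomb s (delta_mx 0 i) = s i.
Proof.
rewrite rcombE (bigD1 i) //= !mxE !eqxx scale1r big1 ?addr0 // => j ji.
by rewrite !mxE (negbTE ji) andbF scale0r.
Qed.

Lemma rV_ext n V (f g : {linear 'rV[S]_n -> V}) :
  (forall i, f (delta_mx 0 i) = g (delta_mx 0 i)) -> f =1 g.
Proof.
move=> fg x; rewrite [x]row_sum_delta !raddf_sum; apply: eq_bigr => i _ /=.
by rewrite !linearZ fg.
Qed.

Lemma fingen_rV_surj V : fingen V -> exists n (f : {linear 'rV[S]_n -> V}),
  surj f.
Proof.
case=> s hs; exists (size s), (rcomb (fun i : 'I_(size s) => s`_i)) => y.
have [c ->] := hs y; exists (\row_i c i); rewrite rcombE.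
by apply: eq_bigr => i _; rewrite mxE.
Qed.

Lemma decode_fingen (c : fgcode S) : fingen (decode c).
Proof.
case: c => n G; apply: (@fingen_surj _ _ (mproj G)); last exact: fingen_rV.
by move=> u; exists (repr u); exact: mproj_repr.
Qed.

Lemma code_exists V : fingen V -> exists c : fgcode S, miso (decode c) V.
Proof.
move=> /fingen_rV_surj[n [f fS]].
by exists (existT _ n [set x | f x = 0]); exact: mquot_miso.
Qed.

Lemma acc_fingen_inj U V (f : {linear U -> V}) : chain_cond V true ->
  injective f -> fingen U.
Proof.
move=> aV fI; have [s [sI Is]] := acc_fg aV (image_submod f).
have /choice[g hg] : forall y, exists x, y \in s -> f x = y.
  by move=> y; have [/sI/asboolP[x e]|_] := boolP (y \in s);
    [exists x|exists 0].
apply/fingenP; exists (map g s) => x.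
pose I : {pred V} := fun y =>
  `[< exists2 x, x \in mspan (gens (map g s)) & f x = y >].
have cI : submod_closed I.
  split; first by apply/asboolP; exists 0; rewrite ?rpred0 ?linear0.
  move=> a y z /asboolP[y' sy <-] /asboolP[z' sz <-]; apply/asboolP.
  by exists (a *: y' + z'); rewrite ?linearP // rpredD ?rpredZ.
have : f x \in mspan (gens s) by apply: Is; apply/asboolP; exists x.
move=> /(mspan_min cI)h.
have /h/asboolP[y sy e] : gens s `<=` [set y | y \in I].
  move=> y ys; apply/asboolP; exists (g y); last exact: hg.
  by apply: mspan_gen; apply: map_f.
by rewrite -(fI _ _ e).
Qed.

End FinGen.

(** * Fitting's lemma and the Krull-Schmidt property *)

Section Fitting.
Variable S : nzRingType.
Implicit Types U V W X Y Z : lmodType S.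

Lemma iter_linear V (e : {linear V -> V}) n : linear (iter n e).
Proof. by elim: n => [//|n IH] a x y; rewrite !iterS IH linearP. Qed.

Definition lpow V (e : {linear V -> V}) n : {linear V -> V} :=
  lin (@iter_linear V e n).

(** The exponent is kept positive: invertibility of the power then gives that of
    [e]. *)
Lemma fitting V (e : {linear V -> V}) : (forall b, chain_cond V b) ->
  exists n, let E := lpow e n.+1 in
    (forall x, exists y, E x = E (E y)) /\ (forall x, E (E x) = 0 -> E x = 0).
Proof.
move=> cV.
have [||n1 h1] := cV false (fun n => image_pred (lpow e n)).
- by move=> n; exact: image_submod.
- move=> n y /asboolP[x <-]; apply/asboolP; exists (e x).
  by rewrite /= -iterSr.
have [||n2 h2] := cV true (fun n => ker_pred (lpow e n)).
- by move=> n; exact: ker_submod.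
- by move=> n x; rewrite !unfold_in /= => /eqP->; rewrite linear0.
pose n := maxn n1 n2; exists n => E.
have EE x : E (E x) = lpow e (n.+1 + n.+1) x by rewrite /= iterD.
have le1 : (n1 <= n)%N by exact: leq_maxl.
have le2 : (n2 <= n)%N by exact: leq_maxr.
split=> [x|x /eqP].
  have : E x \in image_pred (lpow e (n.+1 + n.+1)).
    rewrite h1 -?(h1 n.+1) ?(leq_trans le1) ?leqnSn //;
      last by rewrite (leq_trans (leqnSn n)) ?leq_addr.
    by apply/asboolP; exists x.
  by move=> /asboolP[y <-]; exists y; rewrite EE.
rewrite EE => h; have : x \in ker_pred (lpow e (n.+1 + n.+1)) by exact: h.
rewrite h2 -?(h2 n.+1) ?(leq_trans le2) ?leqnSn //; first by move=> /eqP.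
by rewrite (leq_trans (leqnSn n)) ?leq_addr.
Qed.

Lemma fitting_miso V (E : {linear V -> V}) :
  (forall x, exists y, E x = E (E y)) -> (forall x, E (E x) = 0 -> E x = 0) ->
  miso (mker E * subm [set E x | x in setT])%type V.
Proof.
move=> hI hK; pose i := subm_val [set E x | x in setT].
have iP k : exists y, E y = i k by apply/image_predP; exact: submP.
apply: (@miso_inj_surj _ _ _ (lcopair (mker_val (f := E)) i)).
  apply: lin_inj => -[x k] /= e.
  have [y ey] := iP k.
  have k0 : i k = 0.
    rewrite -ey hK //; have := congr1 E e.
    by rewrite linearD mker_eq0 add0r linear0 ey.
  congr (_, _); last by apply: (@subm_valI _ _ [set E x | x in setT]);
    rewrite linear0.
  by apply: mker_valI; move: e; rewrite k0 addr0.
move=> x; have [y e] := hI x.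
have [k ek] : exists k, i k = E y by apply/submE/image_predP; exists y.
have [m em] : exists m : mker E, mker_val m = x - E y.
  by apply: mkerE; rewrite linearB e subrr.
by exists (m, k); rewrite /= em ek subrK.
Qed.

Definition local_end V : Prop :=
  ~ is_zero V /\ forall e : {linear V -> V}, bijective e \/ exists n, forall x,
    iter n e x = 0.

(** By Fitting's lemma, [V] is the sum of the kernel and the image of a power of
    [e], so one of them is zero. *)
Lemma indec_local V : (forall b, chain_cond V b) -> indecomposable V ->
  local_end V.
Proof.
move=> cV [nV hV]; split=> // e.
have [n [hI hK]] := fitting e cV.
set E := lpow e n.+1 in hI hK.
have [k0|i0] := hV _ _ (miso_sym (fitting_miso hI hK)).
  left; have EI : injective E.
    apply: lin_inj => x hx; have [m <-] := mkerE hx.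
    by rewrite (k0 m).
  have eI : injective e.
    by move=> x y exy; apply: EI; rewrite /= -!iterS !iterSr exy.
  have eS : surj e.
    move=> x; have [y exy] := hI x.
    by exists (iter n e y); rewrite (EI _ _ exy).
  have [g hg] := choice eS.
  by exists g => // x; apply: eI; rewrite hg.
right; exists n.+1 => x.
have [k ek] : exists k, subm_val [set E x | x in setT] k = E x
  by apply/submE/image_predP; exists x.
by rewrite -[iter _ _ _]/(E x) -ek (i0 k) linear0.
Qed.

Lemma inj_nilpotent V (e : {linear V -> V}) n :
  injective e -> (forall x, iter n e x = 0) -> is_zero V.
Proof.
move=> eI hn x; have := hn x; elim: n {hn} => [//|n IH]; rewrite iterS => h.
by apply/IH/eI; rewrite h linear0.
Qed.

(** After division by [u] the two maps add up to the identity; if both were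
    nilpotent, the second one would also be injective. *)
Lemma local_sum V (e e' u : {linear V -> V}) : local_end V ->
  (forall x, e x + e' x = u x) -> bijective u -> bijective e \/ bijective e'.
Proof.
move=> [nV hV] eu bu; have [w [uK wK]] := linv bu.
have red (f : {linear V -> V}) : bijective (w \o f) -> bijective f.
  move=> [g fK gK]; exists (g \o w) => x /=; first exact: fK.
  by apply: (can_inj wK); exact: gK.
have [b1|[n hn]] := hV (w \o e); first by left; exact: red.
have [b2|[m hm]] := hV (w \o e'); first by right; exact: red.
exfalso; apply: nV; apply: inj_nilpotent hm.
apply: lin_inj => y /= h0.
have h : w (e y) = y by rewrite -[RHS]uK -eu linearD h0 addr0.
by rewrite -(hn y); elim: (n) => [//|k IH]; rewrite iterS -IH.
Qed.

(** The identity of [V] is the sum of an endomorphism through [X] and one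
    through [Y]. *)
Lemma local_summand_prod V X Y : local_end V -> summand V (X * Y)%type ->
  summand V X \/ summand V Y.
Proof.
move=> lV /summandE[u [v uK]].
pose e1 : {linear V -> V} := (v \o lpair idfun \0) \o (fst \o u).
pose e2 : {linear V -> V} := (v \o lpair \0 idfun) \o (snd \o u).
have e12 x : e1 x + e2 x = (idfun : {linear V -> V}) x.
  rewrite /e1 /e2 /= -linearD -[RHS]uK; congr (v _).
  by case: (u x) => a b; rewrite /=; congr (_, _); rewrite /= ?addr0 ?add0r.
have [|b|b] := local_sum lV e12; first by exists id.
- by left; apply: summand_retract b.
- by right; apply: summand_retract b.
Qed.

(** Gaussian elimination: the isomorphism [X -> Y] is the Schur complement of
    the invertible corner. *)
Lemma gauss_cancel Z X Y (f : {linear (Z * X)%type -> (Z * Y)%type}) :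
  bijective f -> bijective (fst \o f \o lpair idfun \0 : {linear Z -> Z}) ->
    miso X Y.
Proof.
move=> bf ba; have [a' [aK a'K]] := linv ba.
have [g [fK gK]] := linv bf.
pose z : {linear X -> Z} := \- (a' \o (fst \o f \o lpair \0 idfun)).
pose q : {linear X -> (Z * X)%type} := lpair z idfun.
have f1 y x : (f (y, x)).1 = (f (y, 0)).1 + (f (0, x)).1.
  rewrite -[RHS]/((f (y, 0) + f (0, x)).1) -linearD; congr ((f _).1).
  by congr (_, _); rewrite /= ?addr0 ?add0r.
have h1 x : (f (q x)).1 = 0.
  rewrite f1 /= -[X in X + _]/((fst \o f \o lpair idfun \0)
    (- a' ((f (0, x)).1))).
  by rewrite linearN a'K addNr.
apply: (@miso_inj_surj _ _ _ (snd \o f \o q)).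
  apply: lin_inj => x /= e.
  have : f (q x) = 0 by rewrite [f _]surjective_pairing h1 e.
  by rewrite -(linear0 f) => /(can_inj fK) /(congr1 snd).
move=> y; exists (g (0, y)).2 => /=.
have e : f (g (0, y)) = (0, y) by rewrite gK.
transitivity ((f (g (0, y))).2); last by rewrite e.
congr ((f _).2).
rewrite [RHS]surjective_pairing; congr (_, _); rewrite /=.
apply: (can_inj aK); rewrite linearN a'K /=; apply/eqP;
  rewrite eq_sym -subr_eq0 opprK.
by rewrite -f1 -surjective_pairing e.
Qed.

(** If the corner [a : Z -> Z] of the isomorphism is not invertible, then, as
    [a' a + b' c = 1] for its inverse, [b' c] is, and so is [a + b' c], the
    corner of the isomorphism followed by an elementary automorphism. *)
Lemma local_cancel Z X Y : local_end Z -> miso (Z * X)%type (Z * Y)%type ->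
  miso X Y.
Proof.
move=> lZ /misoE[f [g [fK gK]]].
have bf : bijective f by exists g.
pose a : {linear Z -> Z} := fst \o f \o lpair idfun \0.
pose c : {linear Z -> Y} := snd \o f \o lpair idfun \0.
pose a' : {linear Z -> Z} := fst \o g \o lpair idfun \0.
pose b' : {linear Y -> Z} := fst \o g \o lpair \0 idfun.
have eac x : (a' \o a) x + (b' \o c) x = (idfun : {linear Z -> Z}) x.
  rewrite -[LHS]/((g (a x, 0) + g (0, c x)).1) -linearD.
  have -> : (a x, 0) + (0, c x) = f (x, 0).
    by rewrite [RHS]surjective_pairing; congr (_, _); rewrite /= ?addr0 ?add0r.
  by rewrite fK.
have bij_id : bijective (idfun : {linear Z -> Z}) by exists id.
have [ba|na] := EM (bijective a); first exact: gauss_cancel bf ba.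
have bbc : bijective (b' \o c).
  have [[h hK Kh]|//] := local_sum lZ eac bij_id.
  have [//|[n hn]] := lZ.2 a; case: (lZ.1).
  by apply: inj_nilpotent hn; apply: (can_inj (g := h \o a')) => y; exact: hK.
pose t : {linear (Z * Y)%type -> (Z * Y)%type} := lpair (lcopair idfun b') snd.
pose t' : {linear (Z * Y)%type -> (Z * Y)%type} :=
  lpair (lcopair idfun (\- b')) snd.
have bt : bijective t.
  by exists t' => -[x y] /=; congr (_, _); rewrite ?addrK ?subrK.
have e2 x : (fst \o (t \o f) \o lpair idfun \0 : {linear Z -> Z}) x + (\- a :
  {linear Z -> Z}) x = (b' \o c) x.
  by rewrite /= addrAC subrr add0r.
have [b|[h hK Kh]] := local_sum lZ e2 bbc.
  apply: (@gauss_cancel _ _ _ (t \o f)) b; exact: bij_comp bt bf.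
case: na; exists (fun x => h (- x)) => x; first exact: hK.
by rewrite -[LHS]opprK -[- a _]/((\- a) _) Kh opprK.
Qed.

End Fitting.

(** * Projective modules and decompositions *)

Section Projective.
Variable S : nzRingType.
Implicit Types U V W X Y Z P Q : lmodType S.

Lemma projective_retract P Q (u : {linear P -> Q}) (v : {linear Q -> P}) :
  cancel u v -> projective Q -> projective P.
Proof.
move=> uK pQ M N g f gS; have [h hh] := pQ _ _ g (f \o v) gS.
by exists (h \o u) => x /=; rewrite hh /= uK.
Qed.

Lemma projective_summand P Q : summand P Q -> projective Q -> projective P.
Proof. by case/summandE => u [v uK]; exact: projective_retract uK. Qed.

Lemma projective_miso P Q : miso P Q -> projective P -> projective Q.
Proof. by move=> /miso_sym/miso_summand; exact: projective_summand. Qed.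

Lemma projective_prod P Q : projective P -> projective Q ->
  projective (P * Q)%type.
Proof.
move=> pP pQ M N g f gS.
have [h hh] := pP _ _ g (f \o lpair idfun \0) gS.
have [k kk] := pQ _ _ g (f \o lpair \0 idfun) gS.
exists (lcopair h k) => -[x y] /=; rewrite linearD hh kk /= -linearD.
by congr (f (_, _)); rewrite /= ?addr0 ?add0r.
Qed.

Lemma projective_rV n : projective 'rV[S]_n.
Proof.
move=> M N g f gS; have [s hs] := choice (fun i => gS (f (delta_mx 0 i))).
exists (rcomb s); apply: (rV_ext (f := g \o rcomb s)) => i.
by rewrite -hs /= -[in RHS](rcomb_delta s i).
Qed.

Lemma projective_zero P : is_zero P -> projective P.
Proof.
move=> P0; apply: (projective_miso _ (@projective_rV 0)).
by apply: is_zero_miso => //; exact: zero_rV.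
Qed.

Lemma projective_free (K : choiceType) : projective {freeg K / S}.
Proof.
move=> M N g f gS; have [s hs] := choice (fun k : K => gS (f << k >>)).
exists (fglift s : {linear {freeg K / S} -> M}).
apply: (@freeg_ext _ _ _ (g \o fglift s)) => k.
by rewrite /= fgliftE hs.
Qed.

End Projective.

Section KrullSchmidt.
Variable S : nzRingType.
Hypothesis ccS : forall b, chain_cond (S^o : lmodType S) b.
Implicit Types U V W X Y Z P Q M : lmodType S.
Implicit Types s t : seq {classic (fgcode S)}.

Lemma fingen_cc V b : fingen V -> chain_cond V b.
Proof. exact: cc_fingen. Qed.

Lemma fingen_inj U V (f : {linear U -> V}) : fingen V -> injective f ->
  fingen U.
Proof. by move=> fV; apply: acc_fingen_inj; exact: fingen_cc. Qed.

Lemma fingen_mker U V (f : {linear U -> V}) : fingen U -> fingen (mker f).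
Proof. by move=> fU; exact: (fingen_inj fU (@mker_valI _ _ _ f)). Qed.

Fixpoint dsum s : lmodType S :=
  if s is c :: s' then (decode c * dsum s')%type else 'rV[S]_0.

Lemma dsum_fingen s : fingen (dsum s).
Proof.
elim: s => [|c s IH] /=; first exact: fingen_rV.
by apply: fingen_prod IH; exact: decode_fingen.
Qed.

Lemma dsum_cat s t : miso (dsum (s ++ t)) (dsum s * dsum t)%type.
Proof.
elim: s => [|c s IH] /=.
  by apply: miso_sym; apply: miso_0prod; exact: zero_rV.
apply: miso_trans (miso_prodA _ _ _).
exact: miso_prod (miso_refl _) IH.
Qed.

Lemma dsum_perm s t : perm_eq s t -> miso (dsum s) (dsum t).
Proof.
elim: s t => [|c s IH] t e.
  by move: (perm_size e); case: t {e} => // _; exact: miso_refl.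
have ct : c \in t by rewrite -(perm_mem e) mem_head.
have [p [q et]] : exists p q, t = p ++ c :: q.
  by case/splitPr: ct => p q; exists p, q.
rewrite et; apply: miso_trans (miso_sym (dsum_cat _ _)) => /=.
apply: miso_trans (miso_prodCA _ _ _).
apply: miso_prod; first exact: miso_refl.
apply: miso_trans (dsum_cat _ _); apply: IH.
by rewrite -(perm_cons c) (perm_trans e) // et -cat1s perm_catCA.
Qed.

Definition decomposed V : Prop :=
  exists s, (forall c, c \in s -> indecomposable (decode c)) /\ miso V (dsum s).

Lemma decomposed_miso U V : miso U V -> decomposed V -> decomposed U.
Proof. by move=> UV [s [hs h]]; exists s; split=> //;
  exact: miso_trans UV h. Qed.

Lemma decomposed_prod U V : decomposed U -> decomposed V ->
  decomposed (U * V)%type.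
Proof.
move=> [s [hs h]] [t [ht h']]; exists (s ++ t); split.
  by move=> c; rewrite mem_cat => /orP[/hs|/ht].
exact: miso_trans (miso_prod h h') (miso_sym (dsum_cat _ _)).
Qed.

(** A submodule minimal among those without a decomposition is neither zero nor
    indecomposable, and both summands of a proper splitting decompose. *)
Lemma fingen_decomposed V : fingen V -> decomposed V.
Proof.
move=> fV; apply: contrapT => nV.
have fsub (I : {pred V}) : fingen (subm [set x | x \in I]).
  exact: (fingen_inj fV (@subm_valI _ _ _)).
have [I [[cI nI] minI]] : exists I : {pred V},
    (submod_closed I /\ ~ decomposed (subm [set x | x \in I])) /\
    forall J : {pred V}, submod_closed J /\
      ~ decomposed (subm [set x | x \in J]) ->
      {subset J <= I} -> {subset I <= J}.
  apply: (cc_min (fingen_cc (b := false) fV)) => [I []//|].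
  exists (@full_pred S V); split; first exact: full_submod.
  by apply: contra_not nV; apply: decomposed_miso; apply: miso_sym;
    exact: full_miso.
set W := subm _ in nI.
have part X Y : miso W (X * Y)%type -> ~ is_zero Y -> decomposed X.
  move=> /misoE[f [g [fK gK]]] nY; apply: contrapT => nX; apply: nY => y.
  pose j : {linear X -> V} :=
    subm_val [set x | x \in I] \o (g \o lpair idfun \0).
  have jI : injective j.
    move=> x x' /subm_valI/(can_inj gK) e; exact: (congr1 fst e).
  have JI : {subset I <= image_pred j}.
    apply: minI; last first.
      by move=> v /asboolP[x <-]; rewrite -(mspan_pred _ cI); exact: submP.
    split; first exact: image_submod.
    apply: contra_not nX; apply: decomposed_miso.
    apply: (miso_image jI (@subm_valI _ _ _)) => v; split.
      by move=> h; apply: submE; rewrite mspan_pred;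
        [apply/asboolP|exact: image_submod].
    by move=> [w <-]; have := submP w; rewrite mspan_pred;
      [move/asboolP|exact: image_submod].
  have /JI/asboolP[x /subm_valI/(can_inj gK) e] :
    subm_val [set x | x \in I] (g (0, y)) \in I.
    by rewrite -(mspan_pred _ cI); exact: submP.
  exact: (esym (congr1 snd e)).
have nW0 : ~ is_zero W.
  move=> W0; apply: nI; exists [::]; split=> //.
  by apply: is_zero_miso => //; exact: zero_rV.
apply: nI; have [c cW] := code_exists (fsub I).
have [iW|niW] := EM (indecomposable W).
  exists [:: c : {classic _}]; split.
    by move=> d; rewrite inE => /eqP->; apply: indec_miso iW; exact: miso_sym.
  by apply: miso_sym; apply: miso_trans (miso_prod0 _ (@zero_rV _)) cW.
have [X [Y [h nX nY]]] : exists X Y,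
  [/\ miso W (X * Y)%type, ~ is_zero X & ~ is_zero Y].
  apply: contrapT => nex; apply: niW; split=> // X Y h.
  by apply: contrapT => nz; apply: nex; exists X, Y; split=> // h0; apply: nz;
    [left|right].
apply: (decomposed_miso h); apply: decomposed_prod;
  first exact: (part _ _ h nY).
exact: (part _ _ (miso_trans h (miso_prodC _ _)) nX).
Qed.

Lemma fingen_local V : fingen V -> indecomposable V -> local_end V.
Proof. by move=> fV; apply: indec_local => b; exact: fingen_cc. Qed.

Lemma summand_dsum V s : fingen V -> indecomposable V -> summand V (dsum s) ->
  exists2 c, c \in s & summand V (decode c).
Proof.
move=> fV iV; elim: s => [|c s IH] /=.
  move=> [T /misoE[f [g [fK _]]]]; case: (iV.1) => x.
  have e : f (x, 0) = f 0 by rewrite linear0; exact: zero_rV.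
  exact: (congr1 fst (can_inj fK e)).
case/(local_summand_prod (fingen_local fV iV)) => [h|/IH[d ds h]].
  by exists c; rewrite ?mem_head.
by exists d; rewrite // in_cons ds orbT.
Qed.

Lemma ffunS_miso M n : miso {ffun 'I_n.+1 -> M} (M * {ffun 'I_n -> M})%type.
Proof.
pose f (x : {ffun 'I_n.+1 -> M}) :=
  (x ord0, [ffun i => x (fintype.lift ord0 i)] : {ffun 'I_n -> M}).
have lf : linear f.
  by move=> a x y; congr (_, _); rewrite ?ffunE //; apply/ffunP => i;
    rewrite !ffunE.
pose g (p : M * {ffun 'I_n -> M}) : {ffun 'I_n.+1 -> M} :=
  [ffun i => oapp p.2 p.1 (unlift ord0 i)].
exists (lin lf), g => [x|[a x]].
  by apply/ffunP => i; rewrite ffunE; case: unliftP => [j|] -> //=;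
    rewrite ffunE.
by congr (_, _); rewrite ?ffunE ?unlift_none //; apply/ffunP => i;
  rewrite !ffunE liftK.
Qed.

Lemma summand_ffun V M n : fingen V -> indecomposable V ->
  summand V {ffun 'I_n -> M} -> summand V M.
Proof.
move=> fV iV; elim: n => [|n IH] h.
  have [T /misoE[f [g [fK _]]]] := h; case: (iV.1) => x.
  have e : f (x, 0) = f 0 by apply/ffunP; case.
  exact: (congr1 fst (can_inj fK e)).
have := summand_trans h (miso_summand (ffunS_miso M n)).
by case/(local_summand_prod (fingen_local fV iV)).
Qed.

Lemma fingen_cancel Z X Y : fingen Z -> miso (Z * X)%type (Z * Y)%type ->
  miso X Y.
Proof.
move=> /fingen_decomposed[s [hs Zs]] h.
have {h Zs} : miso (dsum s * X)%type (dsum s * Y)%type.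
  apply: miso_trans (miso_prod (miso_sym Zs) (miso_refl _)) _.
  exact: miso_trans h (miso_prod Zs (miso_refl _)).
elim: s hs => [|c s IH] hs /= h.
  have z U : miso U ('rV[S]_0 * U)%type by exact/miso_sym/miso_0prod/zero_rV.
  exact: miso_trans (z X) (miso_trans h (miso_sym (z Y))).
apply: IH => [d ds|]; first by apply: hs; rewrite in_cons ds orbT.
apply: (@local_cancel _ (decode c)).
  by apply: fingen_local (hs _ (mem_head _ _)); exact: decode_fingen.
apply: miso_trans (miso_prodA _ _ _) _; apply: miso_trans h _.
exact: miso_sym (miso_prodA _ _ _).
Qed.

(** Projective covers: a minimal submodule [I] of a free cover of [M] that is
    projective and still maps onto [M]. If [p \o g] is onto, lift [p] along it
    to [h]; the image of a high power of [g \o h] is a summand of [I] that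
    maps onto [M], hence it is [I]. *)
Lemma proj_cover_exists M : fingen M ->
  exists P (p : {linear P -> M}), proj_cover p /\ fingen P.
Proof.
move=> /fingen_rV_surj[n [f fS]]; pose F : lmodType S := 'rV[S]_n.
have fF : fingen F by exact: fingen_rV.
pose good (I : {pred F}) :=
  [/\ submod_closed I, projective (subm [set x | x \in I])
   & forall y, exists2 x, x \in I & f x = y].
have [I [[cI pI sI] minI]] : exists I, good I /\
    forall J, good J -> {subset J <= I} -> {subset I <= J}.
  apply: (cc_min (fingen_cc (b := false) fF)) => [I []//|].
  exists (@full_pred S F); split; first exact: full_submod.
    by apply: (projective_miso _ (@projective_rV S n)); apply: miso_sym;
      exact: full_miso.
  by move=> y; have [x <-] := fS y; exists x.
set P := subm _ in pI; pose i : {linear P -> F} := subm_val [set x | x \in I].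
have iP x : i x \in I by rewrite -(mspan_pred _ cI); exact: submP.
exists P, (f \o i); split; last exact: (fingen_inj fF (@subm_valI _ _ _)).
have pS : surj (f \o i).
  move=> y; have [x Ix <-] := sI y.
  have [z ez] : exists z, i z = x by apply: submE; rewrite mspan_pred.
  by exists z; rewrite /= ez.
split=> // U g gS.
(* [e] is an endomorphism of [P] over [M]. *)
have [h hh] := pI _ _ (f \o i \o g) (f \o i) gS.
pose e : {linear P -> P} := g \o h.
have ccP b : chain_cond P b
  by apply/fingen_cc/(fingen_inj fF (@subm_valI _ _ _)).
have [m [hI hK]] := fitting e ccP.
set E := lpow e m.+1 in hI hK.
have fE x : f (i (E x)) = f (i x).
  rewrite -[E x]/(iter m.+1 e x); elim: m.+1 => [//|k IH].
  by rewrite -IH iterS; exact: hh.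
have /minI IJ : good (image_pred (i \o E)).
  split; first exact: image_submod.
    apply: projective_summand pI.
    apply: (@summand_trans _ (subm [set E x | x in setT])); last first.
      apply: summand_trans (miso_summand (fitting_miso hI hK)).
      exact: summandr.
    apply: miso_summand.
    apply: (@miso_image _ _ _ _ (subm_val _)
      (i \o subm_val [set E x | x in setT])).
    - exact: subm_valI.
    - by move=> x y /subm_valI/subm_valI.
    move=> x; split=> [[y <-]|[y <-]].
      have := submP y; rewrite mspan_pred; last exact: image_submod.
      move=> /asboolP[z <-].
      have [w ew] : exists w, subm_val [set E x | x in setT] w = E z
        by apply/submE/image_predP; exists z.
      by exists w; exact: (congr1 i ew).
    apply: submE; rewrite mspan_pred; last exact: image_submod.
    have /image_predP[z ez] := submP y.
    by apply/asboolP; exists z; exact: (congr1 i ez).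
  move=> y; have [x xe] := pS y; exists (i (E x)); last by rewrite fE.
  by apply/asboolP; exists x.
have JI : {subset image_pred (i \o E) <= I} by move=> y /asboolP[z <-];
  exact: iP.
move=> x; have /(IJ JI)/asboolP[y /subm_valI <-] : i x \in I by exact: iP.
by exists (h (iter m e y)).
Qed.

End KrullSchmidt.

(** * Stable isomorphism *)

Section Stable.
Variable S : nzRingType.
Implicit Types U V W X Y K F P Q M : lmodType S.

Definition factors_proj U V (h : U -> V) : Prop :=
  exists P (a : {linear U -> P}) (b : {linear P -> V}),
    projective P /\ forall x, h x = b (a x).

(** Isomorphism in the category of modules modulo the maps that factor through
    a projective module. *)
Definition stiso U V : Prop :=
  exists (f : {linear U -> V}) (g : {linear V -> U}),
    factors_proj (fun x => g (f x) - x) /\ factors_proj (fun y => f (g y) - y).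

Lemma factors_proj0 U V : factors_proj (fun _ : U => 0 : V).
Proof.
exists 'rV[S]_0, \0, \0; split; last by move=> x; rewrite /=.
exact: projective_rV.
Qed.

Lemma factors_projD U V (h k : U -> V) :
  factors_proj h -> factors_proj k -> factors_proj (fun x => h x + k x).
Proof.
move=> [P [a [b [pP hE]]]] [Q [c [d [pQ kE]]]].
exists (P * Q)%type, (lpair a c), (lcopair b d).
by split=> [|x]; [exact: projective_prod|rewrite hE kE].
Qed.

Lemma factors_proj_comp U V W X (f : {linear U -> V}) (h : V -> W)
  (g : {linear W -> X}) :
  factors_proj h -> factors_proj (fun x => g (h (f x))).
Proof.
move=> [P [a [b [pP hE]]]]; exists P, (a \o f), (g \o b).
by split=> // x /=; rewrite hE.
Qed.

Lemma stiso_sym U V : stiso U V -> stiso V U.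
Proof. by case=> f [g [h k]]; exists g, f. Qed.

Lemma miso_stiso U V : miso U V -> stiso U V.
Proof.
case/misoE => f [g [fK gK]]; exists f, g; split.
  by have := factors_proj0 U U; congr factors_proj; apply/funext => x;
    rewrite fK subrr.
by have := factors_proj0 V V; congr factors_proj; apply/funext => x;
  rewrite gK subrr.
Qed.

Lemma stiso_refl U : stiso U U.
Proof. exact/miso_stiso/miso_refl. Qed.

Lemma stiso_comp U V W (f : {linear U -> V}) (g : {linear V -> U})
    (f' : {linear V -> W}) (g' : {linear W -> V}) :
  factors_proj (fun x => g (f x) - x) ->
    factors_proj (fun x => g' (f' x) - x) ->
  factors_proj (fun x => (g \o g') ((f' \o f) x) - x).
Proof.
move=> h h'; have := factors_projD (factors_proj_comp f g h') h.
congr factors_proj; apply/funext => x /=.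
by rewrite linearB /= addrA subrK.
Qed.

Lemma stiso_trans V U W : stiso U V -> stiso V W -> stiso U W.
Proof.
move=> [f [g [h k]]] [f' [g' [h' k']]]; exists (f' \o f), (g \o g').
by split; exact: stiso_comp.
Qed.

Lemma stiso_prod U V X Y : stiso U X -> stiso V Y ->
  stiso (U * V)%type (X * Y)%type.
Proof.
have half (U' V' X' Y' : lmodType S) (f : {linear U' -> X'})
  (g : {linear X' -> U'})
   (f' : {linear V' -> Y'}) (g' : {linear Y' -> V'}) :
   factors_proj (fun x => g (f x) - x) ->
     factors_proj (fun x => g' (f' x) - x) ->
   factors_proj (fun x => (lpair (g \o fst) (g' \o snd))
     (lpair (f \o fst) (f' \o snd) x) - x).
  move=> h h'.
  have := factors_projD (factors_proj_comp fst (lpair idfun \0) h)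
    (factors_proj_comp snd (lpair \0 idfun) h').
  congr factors_proj; apply/funext => -[x y] /=.
  by congr (_, _); rewrite /= ?addr0 ?add0r.
move=> [f [g [h k]]] [f' [g' [h' k']]].
exists (lpair (f \o fst) (f' \o snd)), (lpair (g \o fst) (g' \o snd)).
by split; exact: half.
Qed.

Lemma stiso_proj0 P : projective P -> stiso P 'rV[S]_0.
Proof.
move=> pP; exists \0, \0; split.
  exists P, idfun, (\- idfun); split=> // x /=.
  by rewrite add0r.
exists 'rV[S]_0, idfun, (\- idfun); split; first exact: projective_rV.
by move=> x; rewrite /= add0r.
Qed.

Lemma stiso_prod_proj U P : projective P -> stiso (U * P)%type U.
Proof.
move=> pP; apply: stiso_trans (stiso_prod (stiso_refl U) (stiso_proj0 pP)) _.
exact/miso_stiso/miso_prod0/zero_rV.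
Qed.

Lemma miso_proj_stiso U V P Q : projective P -> projective Q ->
  miso (U * P)%type (V * Q)%type -> stiso U V.
Proof.
move=> pP pQ h; apply: stiso_trans (stiso_sym (stiso_prod_proj U pP)) _.
exact: stiso_trans (miso_stiso h) (stiso_prod_proj V pQ).
Qed.

Lemma factors_proj_fingen U V (h : U -> V) : fingen V -> factors_proj h ->
  exists n (a : {linear U -> 'rV[S]_n}) (b : {linear 'rV[S]_n -> V}), forall x,
    h x = b (a x).
Proof.
move=> /fingen_rV_surj[n [q qS]] [P [a [b [pP hE]]]].
have [c hc] := pP _ _ q b qS.
by exists n, (c \o a), q => x; rewrite /= hc hE.
Qed.

(** A stable isomorphism [f] with inverse [g] and [g f = 1 + b a], with [a]
    and [b] through a free module [L], makes [U] a retract of [V * L]; the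
    identity of the complement then factors through a projective module. *)
Lemma stiso_miso U V : fingen U -> stiso U V ->
  exists C n, projective C /\ miso (U * C)%type (V * 'rV[S]_n)%type.
Proof.
move=> fU [f [g [/(factors_proj_fingen fU)[n [a [b hab]]]
  [P [c [d [pP hcd]]]]]]].
pose u : {linear U -> (V * 'rV[S]_n)%type} := lpair f (\- a).
pose v : {linear (V * 'rV[S]_n)%type -> U} := lcopair g b.
have uK : cancel u v.
  by move=> x; rewrite /= linearN -hab opprB addrC subrK.
exists (mker v), n; split; last by apply: (@retract_miso _ _ _ u v); exists id.
pose k : {linear mker v -> (V * 'rV[S]_n)%type} := mker_val (f := v).
pose q : {linear (V * 'rV[S]_n)%type -> (V * 'rV[S]_n)%type} :=
  idfun \- (u \o v).
have [r hr] : exists r : {linear (V * 'rV[S]_n)%type -> mker v}, forall x,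
  k (r x) = q x.
  apply: lift_inj => [|x]; first exact: mker_valI.
  by apply: mkerE; rewrite linearB [v ((u \o v) x)]uK subrr.
pose w : {linear (P * 'rV[S]_n)%type -> (V * 'rV[S]_n)%type} :=
  lpair (\- lcopair d (f \o b)) snd.
apply: (@projective_retract _ _ (P * 'rV[S]_n)%type (lpair (c \o (fst \o k))
  (snd \o k)) (r \o w)).
  move=> x; apply: mker_valI; rewrite -/k [k _]hr.
  have kx : v (k x) = 0 by exact: mker_eq0.
  have -> : w (lpair (c \o (fst \o k)) (snd \o k) x) = k x.
    rewrite [RHS]surjective_pairing; congr (_, _); rewrite /= -hcd.
    have -> : g (k x).1 = - b (k x).2 by apply/eqP; rewrite -addr_eq0;
      apply/eqP; exact: kx.
    by rewrite linearN opprD opprB opprK addrK.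
  by rewrite -[LHS]/(k x - u (v (k x))) kx linear0 subr0.
by apply: projective_prod => //; exact: projective_rV.
Qed.

(** * Presentations and syzygies *)

Definition short_exact K F U (i : {linear K -> F}) (p : {linear F -> U}) :
  Prop :=
  [/\ injective i, surj p & forall x, p x = 0 <-> exists y, i y = x].

Definition syz U K : Prop :=
  exists F (i : {linear K -> F}) (p : {linear F -> U}), projective F /\
    short_exact i p.

(** Homotopy equivalence of the two-term complexes [i] and [i'], as far as it
    concerns the left-hand terms. *)
Definition homotopic K F K' F' (i : {linear K -> F}) (i' : {linear K' -> F'}) :
  Prop :=
  exists (a : {linear K -> K'}) (b : {linear F -> F'}) (a' : {linear K' -> K})
    (b' : {linear F' -> F})
    (s : {linear F -> K}) (s' : {linear F' -> K'}),
    [/\ forall x, i' (a x) = b (i x), forall x, i (a' x) = b' (i' x),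
        forall x, a' (a x) = x + s (i x) & forall x, a (a' x) = x + s' (i' x)].

Lemma homotopic_half K F U K' F' (i : {linear K -> F}) (p : {linear F -> U})
    (i' : {linear K' -> F'}) (a : {linear K -> K'}) (b : {linear F -> F'})
    (a' : {linear K' -> K}) (b' : {linear F' -> F}) (h : U -> U) :
  short_exact i p -> (forall x, i' (a x) = b (i x)) ->
    (forall x, i (a' x) = b' (i' x)) ->
  factors_proj h -> (forall x, p (b' (b x)) = p x + h (p x)) ->
  exists s : {linear F -> K}, forall x, a' (a x) = x + s (i x).
Proof.
move=> [iI pS pi] ha ha' [P [c [d [pP hcd]]]] hb.
have [e he] := pP _ _ p d pS.
have [s hs] : exists s : {linear F -> K}, forall x,
    i (s x) = (((b' \o b) \- (e \o (c \o p))) \- idfun) x.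
  apply: (lift_inj (f := ((b' \o b) \- (e \o (c \o p))) \- idfun)) => // x;
    apply/pi.
  rewrite !linearB /= hb he hcd.
  by rewrite addrK subrr.
exists s => x; apply: iI; rewrite linearD hs ha' ha /=.
have -> : p (i x) = 0 by apply/pi; exists x.
by rewrite !linear0 addr0 addrC subrK.
Qed.

(** As in the comparison theorem for projective resolutions, the stable
    isomorphism and its homotopies lift to the projective modules [F] and
    [F']. What factors through a projective module of the difference between
    [g \o f] and the identity factors through [p] after lifting, so it
    vanishes on [K]. *)
Lemma stiso_homotopic K F U K' F' U' (i : {linear K -> F}) (p : {linear F -> U})
    (i' : {linear K' -> F'}) (p' : {linear F' -> U'}) :
  projective F -> projective F' -> short_exact i p -> short_exact i' p' ->
    stiso U U' ->
  homotopic i i'.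
Proof.
move=> pF pF' ex ex' [f [g [h h']]].
have lift (K1 F1 U1 K2 F2 U2 : lmodType S) (i1 : {linear K1 -> F1})
  (p1 : {linear F1 -> U1})
   (i2 : {linear K2 -> F2}) (p2 : {linear F2 -> U2}) (m : {linear U1 -> U2}) :
   projective F1 -> short_exact i1 p1 -> short_exact i2 p2 ->
   exists (a : {linear K1 -> K2}) (b : {linear F1 -> F2}),
     (forall x, i2 (a x) = b (i1 x)) /\ forall x, p2 (b x) = m (p1 x).
  move=> pF1 [iI1 pS1 pi1] [iI2 pS2 pi2].
  have [b hb] := pF1 _ _ p2 (m \o p1) pS2.
  have [a ha] : exists a : {linear K1 -> K2}, forall x, i2 (a x) = (b \o i1) x.
    apply: lift_inj => // x; apply/pi2; rewrite /= hb /=.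
    have -> : p1 (i1 x) = 0 by apply/pi1; exists x.
    by rewrite linear0.
  by exists a, b.
have [a [b [ha hb]]] := lift _ _ _ _ _ _ _ _ _ _ f pF ex ex'.
have [a' [b' [ha' hb']]] := lift _ _ _ _ _ _ _ _ _ _ g pF' ex' ex.
have [s hs] : exists s : {linear F -> K}, forall x, a' (a x) = x + s (i x).
  apply: (homotopic_half ex ha ha' h) => x.
  by rewrite hb' hb addrC subrK.
have [s' hs'] : exists s : {linear F' -> K'}, forall x, a (a' x) = x + s (i' x).
  apply: (homotopic_half ex' ha' ha h') => x.
  by rewrite hb hb' addrC subrK.
by exists a, b, a', b', s, s'.
Qed.

Lemma homotopic_stiso K F K' F' (i : {linear K -> F}) (i' : {linear K' -> F'}) :
  projective F -> projective F' -> homotopic i i' -> stiso K K'.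
Proof.
move=> pF pF' [a [b [a' [b' [s [s' [_ _ h h']]]]]]].
exists a, a'; split.
  by exists F, i, s; split=> // x; rewrite h addrAC subrr add0r.
by exists F', i', s'; split=> // x; rewrite h' addrAC subrr add0r.
Qed.

Lemma syz_stiso U U' K K' : syz U K -> syz U' K' -> stiso U U' -> stiso K K'.
Proof.
move=> [F [i [p [pF ex]]]] [F' [i' [p' [pF' ex']]]] h.
exact: (homotopic_stiso pF pF' (stiso_homotopic pF pF' ex ex' h)).
Qed.

Lemma syz_prod U V K L : syz U K -> syz V L -> syz (U * V)%type (K * L)%type.
Proof.
move=> [F [i [p [pF [iI pS ex]]]]] [G [j [q [qG [jI qS ex']]]]].
exists (F * G)%type, (lpair (i \o fst) (j \o snd)),
  (lpair (p \o fst) (q \o snd)).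
split; [exact: projective_prod|split].
- by move=> [x y] [x' y'] [/= /iI-> /jI->].
- by move=> [x y]; have [u <-] := pS x; have [v <-] := qS y; exists (u, v).
move=> [x y]; split.
  by move=> [/= /ex[u <-] /ex'[v <-]]; exists (u, v).
by move=> [[u v] /= [<- <-]]; congr (_, _) => /=;
  [apply/ex; exists u|apply/ex'; exists v].
Qed.

Lemma is_syzygy_syz M N : is_syzygy M N -> syz M N.
Proof.
by move=> [P [p [i [[pP pS _] iI ex]]]]; exists P, i, p.
Qed.

Lemma mker_exact F U (p : {linear F -> U}) : surj p ->
  short_exact (mker_val (f := p)) p.
Proof.
move=> pS; split=> //; first exact: mker_valI.
by move=> x; split=> [/mkerE//|[k <-]]; exact: mker_eq0.
Qed.

Lemma syz_exists U : (forall b, chain_cond (S^o : lmodType S) b) -> fingen U ->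
  exists c : fgcode S, syz U (decode c).
Proof.
move=> cS /fingen_rV_surj[n [p pS]].
have fk : fingen (mker p) by apply: fingen_mker => //; exact: fingen_rV.
have [c /misoE[f [g [fK gK]]]] := code_exists fk.
exists c, 'rV[S]_n, (mker_val (f := p) \o f), p; split;
  first exact: projective_rV.
have [kI _ ex] := mker_exact pS; split=> //.
  by apply: inj_comp kI _; exact: can_inj fK.
move=> x; split=> [/ex[k <-]|[y <-]]; first by exists (g k); rewrite /= gK.
by apply/ex; exists (f y).
Qed.

End Stable.

Section StandardResolution.
Variables (R : comNzRingType) (A : algType R).
Implicit Types X : lmodType A.

Lemma free_cover_surj X : surj (free_cover X).
Proof. by move=> x; exists << x >>; exact: (@fgliftE A _ X idfun). Qed.

Lemma nsyz_syz n X : syz (nsyz n X) (nsyz n.+1 X).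
Proof.
exists (res n X), (mker_val (f := free_cover (nsyz n X))),
  (free_cover (nsyz n X)).
split; first exact: projective_free.
exact/mker_exact/free_cover_surj.
Qed.

End StandardResolution.

(** * Tensor products and Tor *)

Lemma lcompE (S : nzRingType) (U V W : lmodType S) (g : {linear V -> W})
  (f : {linear U -> V}) x :
  (g \o f : {linear U -> W}) x = g (f x).
Proof. by []. Qed.

Section TensorFacts.
Variables (R : comNzRingType) (A : algType R).
Implicit Types (Z : lmodType A^c) (P U V W : lmodType A) (M : lmodType R).

Local Notation idl Z := (idfun : {linear Z -> Z}).

Lemma tpureDr Z P (z : Z) (p p' : P) :
  tpure z (p + p') = tpure z p + tpure z p'.
Proof.
apply/eqP; rewrite -subr_eq0 /tpure -linearD -linearB; apply/eqP.
exact/tpure_eq0/TensAddr.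
Qed.

Lemma tpureA Z P (z : Z) (a : A) (p : P) :
  tpure ((a : A^c) *: z) p = tpure z (a *: p).
Proof.
apply/eqP; rewrite -subr_eq0 /tpure -linearB; apply/eqP.
exact/tpure_eq0/TensBal.
Qed.

Lemma tpure0r Z P (z : Z) : tpure z (0 : P) = 0.
Proof. by apply: (addrI (tpure z (0 : P))); rewrite -tpureDr !addr0. Qed.

Lemma tpure0l Z P (p : P) : tpure (0 : Z) p = 0.
Proof. by apply: (addrI (tpure (0 : Z) p)); rewrite -tpureDl !addr0. Qed.

Lemma tpureNr Z P (z : Z) (p : P) : tpure z (- p) = - tpure z p.
Proof. by apply: (addrI (tpure z p)); rewrite -tpureDr !subrr tpure0r. Qed.

Lemma tpure_sumr Z P (z : Z) n (p : 'I_n -> P) :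
  tpure z (\sum_i p i) = \sum_i tpure z (p i).
Proof.
by apply: (big_morph (tpure z)) => [p' q|]; [exact: tpureDr|exact: tpure0r].
Qed.

Lemma tpure_suml Z P n (z : 'I_n -> Z) (p : P) :
  tpure (\sum_i z i) p = \sum_i tpure (z i) p.
Proof.
by apply: (big_morph (fun z => tpure z p)) => [z' q|];
  [exact: tpureDl|exact: tpure0l].
Qed.

Lemma tens_ind Z P (Q : tens Z P -> Prop) :
  Q 0 -> (forall u v, Q u -> Q v -> Q (u + v)) -> (forall z p, Q (tpure z p)) ->
  forall t, Q t.
Proof.
move=> Q0 QD Qp t; rewrite -(mproj_repr t) -[repr t]freeg_sumE linear_sum /=.
elim/big_ind: _ => // -[z p] _.
set c := coeff _ _.
have -> : << c *g (z, p) >> = c *: ptens z p :> {freeg (Z * P)%type / R}.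
  by apply/eqP/freeg_eqP => y; rewrite coeffZ !coeffU mul1r.
by rewrite linearZ /= -[mproj _ _]/(tpure z p) -tpure_scale.
Qed.

Section Lift.
Variables (Z : lmodType A^c) (P : lmodType A) (M : lmodType R)
  (h : Z -> P -> M).
Hypotheses (hDl : forall z z' p, h (z + z') p = h z p + h z' p)
  (hDr : forall z p p', h z (p + p') = h z p + h z p')
  (hA : forall z (a : A) p, h ((a : A^c) *: z) p = h z (a *: p))
  (hR : forall r z p, h (rscale r z) p = r *: h z p).

Let lift_free : {linear {freeg (Z * P)%type / R} -> M} :=
  fglift (fun zp : Z * P => h zp.1 zp.2).

Fact tens_lift_subproof x : tens_rel x -> lift_free x = 0.
Proof.
have E z p : lift_free (ptens z p) = h z p by exact: fgliftE.
have EZ r z p : lift_free (r *: ptens z p) = r *: h z p by rewrite linearZ /= E.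
case=> [z z' p|z p p'|z a p|r z p]; rewrite linearB ?linearD /=.
- by rewrite !E hDl -opprD subrr.
- by rewrite !E hDr -opprD subrr.
- by rewrite !E hA subrr.
- by rewrite E EZ hR subrr.
Qed.

Definition tens_lift : {linear tens Z P -> M} := mquot_lift tens_lift_subproof.

Lemma tens_liftE z p : tens_lift (tpure z p) = h z p.
Proof. by rewrite [LHS]mquot_liftE; exact: fgliftE. Qed.
End Lift.

(** Tensoring is right exact: the quotient of [Z (x) V] by the image of
    [Z (x) U] receives a map from [Z (x) W], by choosing preimages under [g]. *)
Lemma tens_right_exact Z U V W (f : {linear U -> V}) (g : {linear V -> W}) t :
  surj g -> (forall x, g x = 0 -> exists y, f y = x) ->
  tmap (idl Z) g t = 0 -> exists s, tmap (idl Z) f s = t.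
Proof.
move=> gS fg gt; pose G := [set tmap (idl Z) f s | s in setT].
have [s hs] := choice gS.
have eqP' z x y : g x = g y -> mproj G (tpure z x) = mproj G (tpure z y).
  move=> e; have [u hu] : exists u, f u = x - y by apply: fg;
    rewrite linearB e subrr.
  apply/mprojP; rewrite -tpureNr -tpureDr -hu; apply: mspan_gen.
  by exists (tpure z u) => //; rewrite tmapE.
pose h z w := mproj G (tpure z (s w)) : mquot G.
have hDl z z' p : h (z + z') p = h z p + h z' p by rewrite /h tpureDl linearD.
have hDr z p p' : h z (p + p') = h z p + h z p'.
  by rewrite /h -linearD -tpureDr; apply: eqP'; rewrite linearD !hs.
have hA z (a : A) p : h ((a : A^c) *: z) p = h z (a *: p).
  by rewrite /h tpureA; apply: eqP'; rewrite linearZ /= !hs.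
have hR r z p : h (rscale r z) p = r *: h z p by rewrite /h tpure_scale linearZ.
have e : (tens_lift hDl hDr hA hR \o tmap (idl Z) g) =1 mproj G.
  apply: (@tens_ext _ _ _ _ _ (tens_lift hDl hDr hA hR \o tmap (idl Z) g)
    (mproj G)) => z p.
  by rewrite lcompE tmapE tens_liftE; apply: eqP'; rewrite hs.
have := e t; rewrite lcompE gt linear0 -(linear0 (mproj G)) => /esym/mprojP.
by rewrite subr0 => /image_predP.
Qed.

Lemma tmap_surj Z V W (g : {linear V -> W}) : surj g -> surj (tmap (idl Z) g).
Proof.
move=> gS; apply: tens_ind => [|u v [x <-] [y <-]|z w].
- by exists 0; rewrite linear0.
- by exists (x + y); rewrite linearD.
- by have [v <-] := gS w; exists (tpure z v); rewrite tmapE.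
Qed.

Lemma tmap_comp Z U V W (f : {linear U -> V}) (g : {linear V -> W}) t :
  tmap (idl Z) g (tmap (idl Z) f t) = tmap (idl Z) (g \o f) t.
Proof.
apply: (@tens_ext _ _ _ _ _ (tmap (idl Z) g \o tmap (idl Z) f)
  (tmap (idl Z) (g \o f))) => z p.
by rewrite lcompE !tmapE.
Qed.

Lemma tmap_ext Z U V (f g : {linear U -> V}) : f =1 g ->
  tmap (idl Z) f =1 tmap (idl Z) g.
Proof. by move=> fg; apply: tens_ext => z p; rewrite !tmapE fg. Qed.

(** The functor [Z |-> ker (Z (x) K -> Z (x) F)], which is [Tor_1(-, X)] when
    [K -> F -> X] is a presentation with [F] projective. *)
Section KerFunctor.
Variables (K F : lmodType A) (i : {linear K -> F}).

Definition tens_ker Z : lmodType R := mker (tmap (idl Z) i).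
Definition tens_ker_map Z Z' (f : {linear Z -> Z'}) :
  {linear tens_ker Z -> tens_ker Z'} :=
  mker_map (tmap_square f i).

Lemma tens_ker_mapE Z Z' (f : {linear Z -> Z'}) x :
  mker_val (tens_ker_map f x) = tmap f (idl K) (mker_val x).
Proof. by []. Qed.

Lemma tens_ker_map_id Z x : tens_ker_map (idl Z) x = x.
Proof.
apply: mker_valI; rewrite tens_ker_mapE.
by apply: (@tens_ext _ _ _ _ _ (tmap (idl Z) (idl K)) idfun) => z p;
  exact: tmapE.
Qed.

Lemma tens_ker_map_comp Z Z' Z'' (f : {linear Z -> Z'})
  (g : {linear Z' -> Z''}) x :
  tens_ker_map (g \o f) x = tens_ker_map g (tens_ker_map f x).
Proof.
apply: mker_valI; rewrite !tens_ker_mapE.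
apply: (@tens_ext _ _ _ _ _ (tmap (g \o f) (idl K))
  (tmap g (idl K) \o tmap f (idl K))) => z p.
by rewrite lcompE !tmapE.
Qed.

Lemma tens_ker_map_linear Z Z' r (f g h : {linear Z -> Z'}) :
  (forall z, h z = rscale r (f z) + g z) ->
  forall x, tens_ker_map h x = r *: tens_ker_map f x + tens_ker_map g x.
Proof.
move=> hE x; apply: mker_valI; rewrite linearP !tens_ker_mapE.
pose l : {linear tens Z K -> tens Z' K} := r \*:
  tmap f (idl K) \+ tmap g (idl K).
apply: (@tens_ext _ _ _ _ _ (tmap h (idl K)) l) => z p.
by rewrite -[l _]/(r *: tmap _ _ _ + tmap _ _ _) !tmapE hE tpureDl tpure_scale.
Qed.

Definition tens_kerF : rfunctor A :=
  @RFunctor R A (fun Z : fgmod A^c => tens_ker Z)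
    (fun (Z Z' : fgmod A^c) (f : {linear Z -> Z'}) => tens_ker_map f)
    (fun Z : fgmod A^c => @tens_ker_map_id Z)
    (fun Z Z' Z'' : fgmod A^c => @tens_ker_map_comp Z Z' Z'')
    (fun Z Z' : fgmod A^c => @tens_ker_map_linear Z Z').
End KerFunctor.

Lemma nat_iso_trans (F G H : rfunctor A) : nat_iso F G -> nat_iso G H ->
  nat_iso F H.
Proof.
move=> [e [eb en]] [e' [eb' en']]; exists (fun Z : fgmod A^c => e' Z \o e Z);
  split.
  by move=> Z; exact: (bij_comp (eb' Z) (eb Z)).
by move=> Z Z' f x; rewrite /= en en'.
Qed.

Lemma nat_isoE (F G : rfunctor A) : nat_iso F G ->
  exists (e : forall Z : fgmod A^c, {linear fobj F Z -> fobj G Z})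
    (e' : forall Z : fgmod A^c, {linear fobj G Z -> fobj F Z}),
    [/\ forall Z : fgmod A^c, cancel (e Z) (e' Z), forall Z : fgmod A^c,
      cancel (e' Z) (e Z),
        forall (Z Z' : fgmod A^c) (f : {linear Z -> Z'}) x,
          e Z' (fmap F f x) = fmap G f (e Z x)
      & forall (Z Z' : fgmod A^c) (f : {linear Z -> Z'}) x,
        e' Z' (fmap G f x) = fmap F f (e' Z x)].
Proof.
move=> [e [eb en]].
pose e' (Z : fgmod A^c) := projT1 (cid (linv (eb Z))).
have he (Z : fgmod A^c) : cancel (e Z) (e' Z) /\ cancel (e' Z) (e Z).
  by rewrite /e'; case: cid.
exists e, e'; split=> [Z|Z|//|Z Z' f x]; first by case: (he Z).
  by case: (he Z).
have [eK e'K] := he Z; have [eK' e'K'] := he Z'.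
by apply: (can_inj eK'); rewrite e'K' en e'K.
Qed.

Lemma nat_iso_sym (F G : rfunctor A) : nat_iso F G -> nat_iso G F.
Proof.
move=> /nat_isoE[e [e' [eK e'K _ en']]]; exists e'; split=> // Z.
exists (e Z); [exact: e'K|exact: eK].
Qed.

(** On the kernel of [Z (x) K -> Z (x) F] the homotopy, which factors through
    this map, is zero. *)
Lemma homotopic_nat_iso (K F K' F' : lmodType A) (i : {linear K -> F})
  (i' : {linear K' -> F'}) :
  homotopic i i' -> nat_iso (tens_kerF i) (tens_kerF i').
Proof.
move=> [a [b [a' [b' [s [s' [ha ha' h h']]]]]]].
have map (K1 F1 K2 F2 : lmodType A) (i1 : {linear K1 -> F1})
  (i2 : {linear K2 -> F2})
    (c : {linear K1 -> K2}) (d : {linear F1 -> F2}) Z (e : forall x,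
      i2 (c x) = d (i1 x)) :
    forall x, tmap (idl Z) i2 (tmap (idl Z) c x) = tmap (idl Z) d
      (tmap (idl Z) i1 x).
  by move=> x; rewrite !tmap_comp; apply: tmap_ext => y /=.
have hom (K1 F1 K2 F2 : lmodType A) (i1 : {linear K1 -> F1})
  (c : {linear K1 -> K2})
    (c' : {linear K2 -> K1}) (t : {linear F1 -> K1}) Z x :
    (forall x, c' (c x) = x + t (i1 x)) -> tmap (idl Z) i1 x = 0 ->
    tmap (idl Z) c' (tmap (idl Z) c x) = x.
  move=> e x0; rewrite -[RHS]addr0 -[X in _ + X](linear0 (tmap (idl Z) t)) -x0.
  pose l : {linear tens Z K1 -> tens Z K1} :=
    idfun \+ (tmap (idl Z) t \o tmap (idl Z) i1).
  apply: (@tens_ext _ _ _ _ _ (tmap (idl Z) c' \o tmap (idl Z) c) l) => z p.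
  by rewrite lcompE -[l _]/(_ + tmap _ _ (tmap _ _ _)) !tmapE e tpureDr.
exists (fun Z : fgmod A^c => mker_map (map _ _ _ _ _ _ a b Z ha)); split=>
  [Z|Z Z' f x].
  exists (mker_map (map _ _ _ _ _ _ a' b' Z ha')) => x; apply: mker_valI => /=.
    by apply: (hom _ F _ F' i) h _; exact: mker_eq0.
  by apply: (hom _ F' _ F i') h' _; exact: mker_eq0.
apply: mker_valI => /=; exact: tmap_square.
Qed.

Section TorKer.
Variables (d : nat) (X : lmodType A).

Let K := nsyz d.+1 X.
Let i : {linear K -> res d X} := mker_val (f := free_cover (nsyz d X)).
Let q : {linear res d.+1 X -> K} := free_cover K.

Lemma tmap_dif0 Z x : tmap (idl Z)
  (dif d X) x = tmap (idl Z) i (tmap (idl Z) q x).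
Proof. by rewrite tmap_comp. Qed.

Lemma tmap_dif1 Z x : tmap (idl Z) q (tmap (idl Z) (dif d.+1 X) x) = 0.
Proof.
rewrite tmap_comp; transitivity
  ((\0 : {linear tens Z (res d.+2 X) -> tens Z K}) x); last by [].
apply: tens_ext => z p; rewrite tmapE /=.
rewrite -[RHS](tpure0r _ z); congr (tpure z _).
exact: (mker_eq0 (f := free_cover (nsyz d.+1 X))).
Qed.

Let cyc_map Z : {linear mker (tmap (idl Z) (dif_out d.+1 X)) -> tens_ker i Z} :=
  mker_map (u := tmap (idl Z) q) (v := idl (tens Z (res d X)))
    (fun x => esym (tmap_dif0 x)).

Fact tor_ker_subproof Z x :
  hbound (tmap (idl Z) (dif d.+1 X)) x -> cyc_map Z x = 0.
Proof. move=> [u e]; apply: mker_valI.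
rewrite -[LHS]/(tmap (idl Z) q (mker_val x)) e; exact: tmap_dif1. Qed.

Definition tor_ker Z : {linear Tor d.+1 Z X -> tens_ker i Z} :=
  mquot_lift (@tor_ker_subproof Z).

Lemma tor_kerE Z k : mker_val (tor_ker Z (hclass _ k)) = tmap (idl Z) q
  (mker_val k).
Proof. exact: (congr1 (@mker_val _ _ _ _)
  (mquot_liftE (@tor_ker_subproof Z) k)). Qed.

(** Cycles map to the kernel of [Z (x) K -> Z (x) F], where [K] is the next
    standard syzygy and [F] covers [nsyz d X]; by right exactness this is
    onto, and the cycles sent to zero are the boundaries. *)
Lemma tor_nat_iso : nat_iso (TorF d.+1 X) (tens_kerF i).
Proof.
exists (fun Z : fgmod A^c => tor_ker Z); split=> [Z|Z Z' f].
  have inj : injective (tor_ker Z).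
    apply: lin_inj; elim/Tor_ind => k /(congr1 (@mker_val _ _ _ _));
      rewrite tor_kerE linear0 => e.
    have [s hs] : exists s, tmap (idl Z) (mker_val (f := q)) s = mker_val k.
      apply: tens_right_exact e; first exact: free_cover_surj.
      by move=> x; exact: mkerE.
    have [u hu] := tmap_surj (Z := Z) (@free_cover_surj _ _ (nsyz d.+2 X)) s.
    rewrite /hclass -(linear0
      (mproj (hbound (g := tmap (idl Z) (dif_out d.+1 X))
      (tmap (idl Z) (dif d.+1 X))))).
    apply/mprojP; rewrite subr0; apply: mspan_gen; exists u.
    by rewrite -hs -hu tmap_comp.
  have tS : surj (tor_ker Z).
    move=> x; have [t ht] := tmap_surj (Z := Z)
      (@free_cover_surj _ _ (nsyz d.+1 X)) (mker_val x).
    have [k hk] : exists k : mker (tmap (idl Z) (dif_out d.+1 X)),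
      mker_val k = t.
      by apply: mkerE; rewrite tmap_dif0 ht; exact: mker_eq0.
    by exists (hclass _ k); apply: mker_valI; rewrite tor_kerE hk.
  have [g hg] := choice tS.
  by exists g => x; [apply: inj; rewrite hg|exact: hg].
elim/Tor_ind => k; apply: mker_valI.
rewrite [fmap _ _ _]Tor_mapE tens_ker_mapE !tor_kerE.
exact: tmap_square.
Qed.
End TorKer.

Lemma stiso_tor d e (X Y : lmodType A) : stiso (nsyz d X) (nsyz e Y) ->
  nat_iso (TorF d.+1 X) (TorF e.+1 Y).
Proof.
move=> h; apply: nat_iso_trans (tor_nat_iso d X) _.
apply: nat_iso_trans (nat_iso_sym (tor_nat_iso e Y)).
apply: homotopic_nat_iso.
by apply: (stiso_homotopic _ _ _ _ h) => //;
  (exact: projective_free || exact/mker_exact/free_cover_surj).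
Qed.

End TensorFacts.

(** * Tor determines a module up to stable isomorphism *)

(** A copy of [Z] on which [rscale] is the canonical scaling by [R], so that
    linear maps from tensor products can take values in it. *)
Section RestrictScalars.
Variables (R : comNzRingType) (A : algType R) (Z : lmodType A^c).

Definition rmod : Type := Z.
HB.instance Definition _ := GRing.Zmodule.on rmod.

Definition rmod_scale (r : R) (z : rmod) : rmod := rscale (r : R) (z : Z).

Fact rmod_scaleA a b u : rmod_scale a (rmod_scale b u) = rmod_scale (a * b) u.
Proof.
rewrite /rmod_scale /rscale scalerA; congr (_ *: (u : Z)).
by rewrite -[LHS]/(b%:A * a%:A : A) -scalerAl mul1r scalerA mulrC.
Qed.
Fact rmod_scale1 : left_id 1 rmod_scale.
Proof. by move=> u; rewrite /rmod_scale /rscale scale1r; exact: scale1r. Qed.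
Fact rmod_scaleDr : right_distributive rmod_scale +%R.
Proof. by move=> a u v; exact: scalerDr. Qed.
Fact rmod_scaleDl v : {morph rmod_scale^~ v : a b / a + b}.
Proof. by move=> a b; rewrite /rmod_scale /rscale scalerDl;
  exact: scalerDl. Qed.

HB.instance Definition _ := GRing.Zmodule_isLmodule.Build R rmod
  rmod_scaleA rmod_scale1 rmod_scaleDr rmod_scaleDl.
End RestrictScalars.

Section Coordinates.
Variables (R : comNzRingType) (A : algType R).
Implicit Types (Z : lmodType A^c) (P X Y : lmodType A).
Local Notation idl Z := (idfun : {linear Z -> Z}).

Definition rsc Z (a : A) (z : Z) : Z := (a : A^c) *: z.

Lemma rscA Z (a b : A) (z : Z) : rsc a (rsc b z) = rsc (b * a) z.
Proof. by rewrite /rsc scalerA. Qed.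

Lemma rscBl Z (a b : A) (z : Z) : rsc (a - b) z = rsc a z - rsc b z.
Proof. exact: scalerBl. Qed.

Lemma rsc_suml Z n (a : 'I_n -> A) (z : Z) :
  rsc (\sum_i a i) z = \sum_i rsc (a i) z.
Proof. by rewrite /rsc -scaler_suml. Qed.

Lemma rsc_sumr Z n (a : A) (z : 'I_n -> Z) :
  rsc a (\sum_i z i) = \sum_i rsc a (z i).
Proof. exact: scaler_sumr. Qed.

Lemma rsc1 Z (z : Z) : rsc 1 z = z. Proof. exact: scale1r. Qed.
Lemma rsc0 Z (z : Z) : rsc 0 z = 0. Proof. exact: scale0r. Qed.

Lemma rsc_lin Z Z' (f : {linear Z -> Z'}) a z : f (rsc a z) = rsc a (f z).
Proof. by rewrite /rsc linearZ. Qed.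

Lemma tens_coord Z n (j : 'I_n) :
  exists c : {linear tens Z 'rV[A]_n -> rmod Z}, forall z v,
    c (tpure z v) = rsc (v 0 j) z.
Proof.
pose h (z : Z) (v : 'rV[A]_n) : rmod Z := rsc (v 0 j) z.
have hDl z z' p : h (z + z') p = h z p + h z' p by exact: (@scalerDr A^c Z).
have hDr z p p' : h z (p + p') = h z p + h z p' by rewrite /h mxE;
  exact: (@scalerDl A^c Z).
have hA z (a : A) p : h ((a : A^c) *: z) p = h z (a *:
  p) by rewrite /h mxE -rscA.
have hR r z p : h (rscale r z) p = r *: h z p.
  rewrite -[RHS]/(rsc (r%:A)
    (rsc (p 0 j) z)) /h -[rscale r z]/(rsc r%:A z) !rscA.
  by rewrite -scalerAl -scalerAr mul1r mulr1.
by exists (tens_lift hDl hDr hA hR) => z v; exact: tens_liftE.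
Qed.

Lemma tens_coord_sum Z n m (z : 'I_m -> Z) (v : 'I_m -> 'rV[A]_n)
    m' (z' : 'I_m' -> Z) (v' : 'I_m' -> 'rV[A]_n) j :
  \sum_i tpure (z i) (v i) = \sum_i tpure (z' i) (v' i) ->
  \sum_i rsc (v i 0 j) (z i) = \sum_i rsc (v' i 0 j) (z' i).
Proof.
have [c hc] := tens_coord Z j => /(congr1 c); rewrite !linear_sum.
rewrite (eq_bigr (fun i => rsc (v i 0 j) (z i) : rmod Z)); last by move=> i _;
  exact: hc.
by rewrite [X in _ = X ->
  _](eq_bigr (fun i => rsc (v' i 0 j) (z' i) : rmod Z)) // => i _; exact: hc.
Qed.

Lemma tens_sum Z P (t : tens Z P) :
  exists n (z : 'I_n -> Z) (p : 'I_n -> P), t = \sum_i tpure (z i) (p i).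
Proof.
elim/tens_ind: t => [|u v [n [z [p ->]]] [m [w [q ->]]]|z p].
- by exists 0%N, (fun=> 0), (fun=> 0); rewrite big_ord0.
- exists (n + m)%N, (fun i => match fintype.split i with inl j => z j | inr j =>
  w j end),
    (fun i => match fintype.split i with inl j => p j | inr j => q j end).
  rewrite big_split_ord /=; congr (_ + _); apply: eq_bigr => i _.
    case: fintype.splitP => j e; last by have := ltn_ord i;
      rewrite [X in (X < _)%N]e ltnNge leq_addr.
    by have -> : i = j by apply: val_inj; exact: e.
  case: fintype.splitP => j e; first by have := ltn_ord j;
    rewrite -[X in (X < _)%N]e ltnNge leq_addr.
  by have -> : i = j by apply: val_inj; exact: (addnI e).
- by exists 1%N, (fun=> z), (fun=> p); rewrite big_ord1.
Qed.

(** The transpose of the module presented by [B]: the right module of columns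
    modulo the columns [B w]. *)
Section Transpose.
Variables (m n : nat) (B : 'M[A]_(m, n)).

Definition tr_rel : set 'rV[A^c]_m :=
  [set v | exists w : 'cV[A]_n, forall i, v 0 i = (B *m w) i 0].

Definition tr_code : fgcode A^c := existT (fun m => set 'rV[A^c]_m) m tr_rel.
Definition trB : fgmod A^c := FGMod (decode_fingen tr_code).
Definition tr_proj : {linear 'rV[A^c]_m -> trB} := mproj tr_rel.
Definition tr_gen (i : 'I_m) : trB := tr_proj (delta_mx 0 i).

Lemma tr_proj_sum (v : 'rV[A^c]_m) : tr_proj v = \sum_i rsc (v 0 i) (tr_gen i).
Proof.
rewrite {1}[v]row_sum_delta linear_sum; apply: eq_bigr => i _.
by rewrite linearZ.
Qed.

Lemma tr_rel_submod : submod_closed [pred v | `[< tr_rel v >]].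
Proof.
split; first by apply/asboolP; exists 0 => i; rewrite mulmx0 !mxE.
move=> a u v /asboolP[w hw] /asboolP[w' hw']; apply/asboolP.
exists (\col_j (w j 0 * (a : A)) + w') => i; rewrite mulmxDr !mxE hw hw' !mxE;
  congr (_ + _).
rewrite -[LHS]/((\sum_j B i j * w j 0) * (a : A)) mulr_suml.
by apply: eq_bigr => j _; rewrite !mxE mulrA.
Qed.

Lemma tr_proj0 (v : 'rV[A^c]_m) :
  tr_proj v = 0 -> exists w : 'cV[A]_n, forall i, v 0 i = (B *m w) i 0.
Proof.
rewrite -(linear0 tr_proj) => /mprojP; rewrite subr0 => h.
apply/asboolP; apply: (mspan_min tr_rel_submod _ h) => u hu; exact/asboolP.
Qed.

Lemma tr_gen_sum0 (c : 'I_m -> A) : \sum_i rsc (c i) (tr_gen i) = 0 ->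
  exists w : 'cV[A]_n, forall i, c i = (B *m w) i 0.
Proof.
move=> h; pose v : 'rV[A^c]_m := \row_i (c i : A^c).
have [|w hw] := @tr_proj0 v.
  by rewrite tr_proj_sum -[RHS]h; apply: eq_bigr => i _; rewrite mxE.
by exists w => i; rewrite -hw mxE.
Qed.

Lemma tr_gen_rel j : \sum_i rsc (B i j) (tr_gen i) = 0.
Proof.
pose v : 'rV[A^c]_m := \row_i (B i j : A^c).
have -> : \sum_i rsc (B i j) (tr_gen i) = tr_proj v.
  by rewrite tr_proj_sum; apply: eq_bigr => i _; rewrite mxE.
rewrite -(linear0 tr_proj); apply/mprojP; rewrite subr0; apply: mspan_gen.
exists (delta_mx j 0) => i;
  rewrite !mxE (bigD1 j) //= !mxE !eqxx mulr1 big1 ?addr0 // => k kj.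
by rewrite !mxE (negbTE kj) mulr0.
Qed.

Lemma tr_lift Z (z : 'I_m -> Z) : (forall j, \sum_i rsc (B i j) (z i) = 0) ->
  exists f : {linear trB -> Z}, forall i, f (tr_gen i) = z i.
Proof.
move=> hz; have h v : tr_rel v -> rcomb z v = 0.
  move=> [w hw]; rewrite rcombE.
  transitivity (\sum_i \sum_j rsc (w j 0) (rsc (B i j) (z i))).
    apply: eq_bigr => i _; rewrite hw mxE -[LHS]/(rsc _ _) rsc_suml.
    by apply: eq_bigr => j _; rewrite rscA.
  rewrite exchange_big big1 // => j _; rewrite -rsc_sumr hz; exact: scaler0.
exists (mquot_lift h) => i; rewrite [LHS]mquot_liftE; exact: rcomb_delta.
Qed.

Lemma tr_gen_coord (z : trB) : exists c : 'I_m -> A, z = \sum_i rsc (c i)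
  (tr_gen i).
Proof.
have [v <-] : exists v, tr_proj v = z by exists (repr z); exact: mproj_repr.
by exists (fun i => v 0 i); exact: tr_proj_sum.
Qed.
End Transpose.

Lemma tr_matrix m n (B : 'M[A]_(m, n)) m' (z : 'I_m' -> trB B) :
  exists D : 'M[A]_(m, m'), forall i, z i = \sum_k rsc (D k i) (tr_gen B k).
Proof.
have [D hD] := choice (fun i => tr_gen_coord (z i)).
by exists (\matrix_(k, i) D i k) => i; rewrite {1}hD; apply: eq_bigr => k _;
  rewrite mxE.
Qed.

Lemma tr_matrix0 m n (B : 'M[A]_(m, n)) m' (D : 'M[A]_(m, m')) :
  (forall i, \sum_k rsc (D k i) (tr_gen B k) = 0) -> exists C : 'M[A]_(n, m'),
    D = B *m C.
Proof.
move=> h; have [C hC] := choice (fun i => tr_gen_sum0 (h i)).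
exists (\matrix_(k, i) C i k 0); apply/matrixP => k i; rewrite hC !mxE.
by apply: eq_bigr => j _; rewrite mxE.
Qed.

Definition presents m n (B : 'M[A]_(m, n)) (X : lmodType A)
  (p : {linear 'rV[A]_n -> X}) :=
  surj p /\ forall r, p r = 0 <-> exists s, s *m B = r.

Section Presented.
Variables (m n : nat) (B : 'M[A]_(m, n)) (X : lmodType A)
  (p : {linear 'rV[A]_n -> X}).
Hypothesis pP : presents B p.

Let K : lmodType A := mker p.
Let i : {linear K -> 'rV[A]_n} := mker_val (f := p).

Fact row_ker (j : 'I_m) : row j B \in ker_pred p.
Proof. by apply/eqP/(pP.2 _).2; exists (delta_mx 0 j); rewrite rowE. Qed.
Definition ker_gen (j : 'I_m) : K := MKer (row_ker j).

Definition ker_cover : {linear 'rV[A]_m -> K} := rcomb ker_gen.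

Lemma ker_coverE s : i (ker_cover s) = s *m B.
Proof. by rewrite /ker_cover rcombE linear_sum mulmx_sum_row; apply: eq_bigr =>
  j _; rewrite linearZ. Qed.

Lemma ker_cover_surj : surj ker_cover.
Proof.
move=> k; have /(pP.2 _).1[s hs] := mker_eq0 k.
by exists s; apply: mker_valI; rewrite -hs -ker_coverE.
Qed.

Definition ker_sum Z (z : 'I_m -> Z) : tens Z K := \sum_j tpure (z j)
  (ker_gen j).

Lemma tmap_ker_sum Z (z : 'I_m -> Z) :
  tmap (idl Z) i (ker_sum z) = \sum_j tpure (z j) (row j B).
Proof. by rewrite /ker_sum linear_sum; apply: eq_bigr => j _;
  rewrite tmapE. Qed.

Lemma ker_sum_ex Z (t : tens Z K) : exists z, t = ker_sum z.
Proof.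
elim/tens_ind: t => [|u v [z ->] [w ->]|z k].
- by exists (fun=> 0); rewrite /ker_sum big1 // => j _; exact: tpure0l.
- by exists (fun j => z j + w j); rewrite /ker_sum -big_split; apply: eq_bigr =>
  j _; rewrite tpureDl.
have [s <-] := ker_cover_surj k.
exists (fun j => rsc (s 0 j) z); rewrite /ker_cover rcombE tpure_sumr.
by apply: eq_bigr => j _; rewrite /rsc tpureA.
Qed.

Lemma ker_sum_eq0 Z (z : 'I_m -> Z) :
  tmap (idl Z) i (ker_sum z) = 0 <-> forall j, \sum_k rsc (B k j) (z k) = 0.
Proof.
rewrite tmap_ker_sum; split=> [h j|h].
  have := @tens_coord_sum Z n m z (fun j => row j B) 0 (fun=> 0) (fun=> 0) j.
  rewrite !big_ord0 h => /(_ erefl) e; rewrite -[RHS]e; apply: eq_bigr => k _.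
  by rewrite mxE.
transitivity (\sum_k \sum_j tpure (rsc (B k j) (z k))
  (delta_mx 0 j : 'rV[A]_n)).
  apply: eq_bigr => k _; rewrite [row k B]row_sum_delta tpure_sumr.
  by apply: eq_bigr => j _; rewrite /rsc tpureA mxE.
by rewrite exchange_big big1 // => j _; rewrite -tpure_suml h tpure0l.
Qed.

Fact tr_elt_ker : tmap (idl (trB B)) i (ker_sum (tr_gen B)) = 0.
Proof. by apply/ker_sum_eq0; exact: tr_gen_rel. Qed.

Definition tr_elt : tens_ker i (trB B) :=
  MKer (introT eqP tr_elt_ker : _ \in ker_pred _).

Lemma tens_ker_map_elt Z (f : {linear trB B -> Z}) :
  mker_val (tens_ker_map i f tr_elt) = ker_sum (f \o tr_gen B).
Proof.
rewrite tens_ker_mapE -[mker_val tr_elt]/(ker_sum (tr_gen B)) /ker_sum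
  linear_sum.
by apply: eq_bigr => j _; rewrite tmapE.
Qed.

(** A general element of [Z (x) K] is [ker_sum z], and it dies in [Z (x) F]
    exactly when [z] satisfies the relations of the transpose; so [tr_elt]
    generates [Tor_1(-, X)]. *)
Lemma tr_elt_gen Z (t : tens_ker i Z) : exists f : {linear trB B -> Z},
  tens_ker_map i f tr_elt = t.
Proof.
have [z hz] := ker_sum_ex (mker_val t).
have [|f hf] := @tr_lift _ _ B Z z.
  by apply/ker_sum_eq0; rewrite -hz; exact: mker_eq0.
exists f; apply: mker_valI; rewrite tens_ker_map_elt hz /ker_sum.
by apply: eq_bigr => j _; rewrite /= hf.
Qed.

(** The two families of values define the same element of [Z (x) K]. By right
    exactness, applied to the cover of [K] by the rows of [B], their
    difference comes from the tensor product of [Z] with the relations between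
    these rows; the rows of [E] are the relations that occur. *)
Lemma tr_elt_eq Z (f g : {linear trB B -> Z}) :
  tens_ker_map i f tr_elt = tens_ker_map i g tr_elt ->
  exists l (E : 'M[A]_(l, m)) (w : 'I_l -> Z), E *m B = 0 /\
    forall k, f (tr_gen B k) - g (tr_gen B k) = \sum_q rsc (E q k) (w q).
Proof.
move=> /(congr1 (@mker_val _ _ _ _)); rewrite !tens_ker_map_elt => e.
pose d k := f (tr_gen B k) - g (tr_gen B k).
have d0 : tmap (idl Z) ker_cover (\sum_k tpure (d k)
  (delta_mx 0 k : 'rV[A]_m)) = 0.
  transitivity (ker_sum d).
    by rewrite linear_sum; apply: eq_bigr => k _; rewrite tmapE rcomb_delta.
  have <- : ker_sum (f \o tr_gen B) - ker_sum (g \o tr_gen B) = 0 by rewrite e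
    subrr.
  rewrite /ker_sum -sumrB.
  apply: eq_bigr => k _; apply/eqP; rewrite eq_sym subr_eq /= -tpureDl /d.
  by rewrite subrK.
have [s hs] := tens_right_exact ker_cover_surj (@mkerE _ _ _ ker_cover) d0.
have [l [w [q e']]] := tens_sum s.
exists l, (\matrix_j mker_val (q j)), w; split.
  apply/row_matrixP => j; rewrite row_mul rowK row0 -ker_coverE mker_eq0.
  exact: linear0.
move=> k; rewrite -/(d k).
transitivity (\sum_j rsc ((delta_mx 0 j : 'rV[A]_m) 0 k) (d j)).
  rewrite (bigD1 k) //= mxE !eqxx rsc1 big1 ?addr0 // => j jk.
  by rewrite mxE eq_sym (negbTE jk) andbF rsc0.
rewrite (@tens_coord_sum Z _ _ d (fun j => delta_mx 0 j) l w (fun j =>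
  mker_val (q j)) k).
  by apply: eq_bigr => j _; rewrite mxE.
by rewrite -hs e' linear_sum; apply: eq_bigr => j _; rewrite tmapE.
Qed.

Lemma pres_lift Y (q : {linear 'rV[A]_n -> Y}) : (forall s, q (s *m B) = 0) ->
  exists f : {linear X -> Y}, forall r, f (p r) = q r.
Proof.
move=> hq; have [s hs] := choice pP.1.
have eq r r' : p r = p r' -> q r = q r'.
  move=> e; have /(pP.2 _).1[u hu] : p (r - r') = 0 by rewrite linearB e subrr.
  by apply/eqP; rewrite -subr_eq0 -linearB -hu hq.
have lf : linear (q \o s).
  by move=> a x y /=; rewrite -linearP; apply: eq; rewrite linearP !hs.
by exists (lin lf) => r /=; apply: eq; rewrite hs.
Qed.
End Presented.

Lemma tr_map_matrix m n (B : 'M[A]_(m, n)) m' n' (B' : 'M[A]_(m', n'))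
    (f : {linear trB B' -> trB B}) :
  exists (D : 'M[A]_(m, m')) (C : 'M[A]_(n, n')), D *m B' = B *m C /\
    forall i, f (tr_gen B' i) = \sum_k rsc (D k i) (tr_gen B k).
Proof.
have [D hD] := tr_matrix (fun i => f (tr_gen B' i)).
have [j|C hC] := @tr_matrix0 _ _ B _ (D *m B'); last by exists D, C.
rewrite -[RHS](linear0 f) -(tr_gen_rel B' j) [RHS]linear_sum.
transitivity (\sum_k \sum_l rsc (B' l j) (rsc (D k l) (tr_gen B k))).
  apply: eq_bigr => k _; rewrite mxE rsc_suml.
  by apply: eq_bigr => l _; rewrite rscA.
rewrite exchange_big; apply: eq_bigr => l _.
by rewrite rsc_lin hD rsc_sumr.
Qed.

(** With [D], [C] and [D'], [C'] the matrices of [f] and [g], the hypothesis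
    gives [D D' - 1 = W E + B V] with [E B = 0]; multiplied by [B] this reads
    [B (C C' - 1 - V B) = 0], so that [C C' - 1] induces on [X] a map through
    a free module. *)
Lemma tr_half m n (B : 'M[A]_(m, n)) X (p : {linear 'rV[A]_n -> X})
  (pP : presents B p)
    m' n' (B' : 'M[A]_(m', n')) (f : {linear trB B' -> trB B})
      (g : {linear trB B -> trB B'})
    D C D' C' (u : {linear X -> X}) :
  tens_ker_map _ (f \o g) (tr_elt pP) = tr_elt pP ->
  D *m B' = B *m C -> D' *m B = B' *m C' ->
  (forall i, f (tr_gen B' i) = \sum_k rsc (D k i) (tr_gen B k)) ->
  (forall i, g (tr_gen B i) = \sum_k rsc (D' k i) (tr_gen B' k)) ->
  (forall r, u (p r) = p (r *m (C *m C'))) ->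
  factors_proj (fun x => u x - x).
Proof.
move=> fg DB DB' fD gD hu.
have [|l [E [w [EB hE]]]] := @tr_elt_eq _ _ B X p pP _ (f \o g) (idl (trB B)).
  by rewrite tens_ker_map_id.
have [W hW] := tr_matrix w.
have [i|V hV] := @tr_matrix0 _ _ B _ (D *m D' - 1%:M - W *m E).
  have hfg : f (g (tr_gen B i)) = \sum_k rsc ((D *m D') k i) (tr_gen B k).
    rewrite gD linear_sum; under eq_bigr => k _ do rewrite rsc_lin fD rsc_sumr.
    rewrite exchange_big; apply: eq_bigr => k _; rewrite mxE rsc_suml.
    by apply: eq_bigr => j _; rewrite rscA.
  have h1 : tr_gen B i = \sum_k rsc ((1%:M : 'M[A]_m) k i) (tr_gen B k).
    rewrite (bigD1 i) //= mxE eqxx rsc1 big1 ?addr0 // => k ki.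
    by rewrite mxE (negbTE ki) rsc0.
  have hWE : \sum_q rsc (E q i) (w q) = \sum_k rsc ((W *m E) k i) (tr_gen B k).
    under eq_bigr => q _ do rewrite hW rsc_sumr.
    rewrite exchange_big; apply: eq_bigr => k _; rewrite mxE rsc_suml.
    by apply: eq_bigr => j _; rewrite rscA.
  have := hE i; rewrite /= hfg h1 hWE => /eqP; rewrite -subr_eq0 => /eqP e.
  rewrite -[RHS]e -!sumrB; apply: eq_bigr => k _.
  by rewrite -!rscBl !mxE.
pose H := C *m C' - 1%:M - V *m B.
have BH : B *m H = 0.
  have := congr1 (fun M => M *m B) hV;
    rewrite !mulmxBl -!mulmxA EB mulmx0 subr0 mul1mx DB'.
  rewrite (mulmxA D) DB -(mulmxA B) => e.
  by rewrite /H !mulmxBr mulmx1 e subrr.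
have [|a ha] := @pres_lift _ _ B X p pP _ (mulmxr H :
  {linear 'rV[A]_n -> 'rV[A]_n}).
  by move=> s; rewrite /= -mulmxA BH mulmx0.
exists 'rV[A]_n, a, p; split; first exact: projective_rV.
move=> x; have [r <-] := pP.1 x; rewrite ha hu /= /H !mulmxBr mulmx1 !linearB.
have -> : p (r *m (V *m B)) = 0 by apply/(pP.2 _).2; exists (r *m V);
  rewrite mulmxA.
by rewrite subr0.
Qed.

Lemma tor_stiso_presented m n (B : 'M[A]_(m, n)) X (p : {linear 'rV[A]_n -> X})
    m' n' (B' : 'M[A]_(m', n')) Y (p' : {linear 'rV[A]_n' -> Y}) :
  presents B p -> presents B' p' ->
  nat_iso (tens_kerF (mker_val (f := p))) (tens_kerF (mker_val (f := p'))) ->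
    stiso X Y.
Proof.
move=> pP pP' /nat_isoE[e [e' [eK Ke en en']]].
have [f hf] := tr_elt_gen pP' (e (trB B) (tr_elt pP)).
have [g hg] := tr_elt_gen pP (e' (trB B') (tr_elt pP')).
have fg : tens_ker_map _ (f \o g) (tr_elt pP) = tr_elt pP.
  rewrite tens_ker_map_comp hg;
    transitivity (e' _ (tens_ker_map _ f (tr_elt pP'))).
    exact: (esym (en' _ _ f _)).
  rewrite hf; exact: eK.
have gf : tens_ker_map _ (g \o f) (tr_elt pP') = tr_elt pP'.
  rewrite tens_ker_map_comp hf;
    transitivity (e _ (tens_ker_map _ g (tr_elt pP))).
    exact: (esym (en _ _ g _)).
  rewrite hg; exact: Ke.
have [D [C [DC fD]]] := tr_map_matrix f.
have [D' [C' [DC' gD]]] := tr_map_matrix g.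
have [|u hu] := pres_lift pP (q := p' \o mulmxr C).
  by move=> s; apply/(pP'.2 _).2; exists (s *m D); rewrite /= -!mulmxA DC.
have [|v hv] := pres_lift pP' (q := p \o mulmxr C').
  by move=> s; apply/(pP.2 _).2; exists (s *m D'); rewrite /= -!mulmxA DC'.
exists u, v; split.
  apply: (tr_half (u := v \o u) fg DC DC' fD gD) => r.
  by rewrite /= hu /= hv /= mulmxA.
apply: (tr_half (u := u \o v) gf DC' DC gD fD) => r.
by rewrite /= hv /= hu /= mulmxA.
Qed.

Lemma fingen_presents X : (forall b, chain_cond (A^o : lmodType A) b) ->
  fingen X ->
  exists m n (B : 'M[A]_(m, n)) (p : {linear 'rV[A]_n -> X}), presents B p.
Proof.
move=> ccA /fingen_rV_surj[n [p pS]].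
have fk : fingen (mker p) by apply: fingen_mker => //; exact: fingen_rV.
have [m [q qS]] := fingen_rV_surj fk.
exists m, n, (\matrix_j mker_val (q (delta_mx 0 j))), p; split=> // r.
have E s : s *m \matrix_j mker_val (q (delta_mx 0 j)) = mker_val (q s).
  rewrite mulmx_sum_row {2}[s]row_sum_delta !linear_sum.
  by apply: eq_bigr => j _; rewrite !linearZ rowK.
split=> [/mkerE[k <-]|[s <-]]; last by rewrite E mker_eq0.
by have [s <-] := qS k; exists s.
Qed.

End Coordinates.

(** * The group K(A) *)

Lemma int_submod (V : lmodType int) (I : {pred V}) :
  0 \in I -> (forall x y, x \in I -> y \in I -> x - y \in I) -> submod_closed I.
Proof.
move=> I0 IB; have IN x : x \in I -> - x \in I by move=> Ix; rewrite -sub0r IB.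
have ID x y : x \in I -> y \in I -> x + y \in I by move=> Ix Iy;
  rewrite -[y]opprK IB ?IN.
have IM x n : x \in I -> x *+ n \in I.
  by move=> Ix; elim: n => [|n IH]; rewrite ?mulr0n // mulrS ID.
split=> // a x y Ix Iy; apply: ID => //.
rewrite -[a]intz scaler_int; case: a => n; first exact: IM.
by rewrite NegzE mulrNz; apply/IN/IM.
Qed.

Section KGroup.
Variable A : nzRingType.
Hypothesis ccA : forall b, chain_cond (A^o : lmodType A) b.
Implicit Types M N U V W X Y P : lmodType A.
Implicit Types c d : fgcode A.
Implicit Types s t : seq {classic (fgcode A)}.

Lemma Kclass_sum c d e : miso (decode c) (decode d * decode e)%type ->
  Kclass c = Kclass d + Kclass e.
Proof.
move=> h; apply/eqP; rewrite -subr_eq0 opprD addrA /Kclass -!linearB; apply/eqP.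
by rewrite -(linear0 (mproj _)); apply/mprojP; rewrite subr0;
  exact/mspan_gen/KSum.
Qed.

Lemma Kclass_proj c : projective (decode c) -> Kclass c = 0.
Proof.
move=> h; rewrite /Kclass -(linear0 (mproj _)); apply/mprojP; rewrite subr0.
exact/mspan_gen/KProj.
Qed.

Lemma Kclass_miso_proj c d P : projective P -> fingen P ->
  miso (decode c) (decode d * P)%type -> Kclass c = Kclass d.
Proof.
move=> pP /code_exists[e eP] h.
rewrite (@Kclass_sum c d e);
  last exact: miso_trans h (miso_prod (miso_refl _) (miso_sym eP)).
by rewrite (Kclass_proj (projective_miso (miso_sym eP) pP)) addr0.
Qed.

Lemma stiso_Kclass c d : stiso (decode c) (decode d) -> Kclass c = Kclass d.
Proof.
move=> /(stiso_miso (decode_fingen c))[C [n [pC h]]].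
have fL := fingen_prod (decode_fingen d) (@fingen_rV A n).
have [e eL] := code_exists fL.
have fC : fingen C.
  apply: fingen_summand fL; apply: summand_trans (miso_summand h);
    exact: summandr.
rewrite -(@Kclass_miso_proj e c C) //; last exact: miso_trans eL (miso_sym h).
by apply: Kclass_miso_proj eL; [exact: projective_rV|exact: fingen_rV].
Qed.

Lemma Kclass_dsum c s : miso (decode c) (dsum s) ->
  Kclass c = \sum_(d <- s) Kclass d.
Proof.
elim: s c => [|d s IH] c h.
  rewrite big_nil Kclass_proj //; apply: projective_zero.
  exact: miso_zero (miso_sym h) (@zero_rV _).
have [e es] := code_exists (dsum_fingen s).
rewrite big_cons -(IH _ es); apply: Kclass_sum; apply: miso_trans h _.
exact: miso_prod (miso_refl _) (miso_sym es).
Qed.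

Definition gsum s : code_free A := \sum_(d <- s) code_gen d.

Lemma gsum_cat s t : gsum (s ++ t) = gsum s + gsum t.
Proof. by rewrite /gsum big_cat. Qed.

Lemma gsum_coeff (x : {classic (fgcode A)}) s :
  coeff x (gsum s) = (count_mem x s)%:R.
Proof.
elim: s => [|c s IH]; first by rewrite /gsum big_nil coeff0.
rewrite /gsum big_cons coeffD -/(gsum s) IH coeffU mul1r /=.
by rewrite natrD.
Qed.

Lemma gsum_perm s t : gsum s = gsum t -> perm_eq s t.
Proof.
move=> e; apply/allP => x _ /=; apply/eqP.
by have := gsum_coeff x s; rewrite e gsum_coeff !natz => -[->].
Qed.

(** Both kinds of relations have this form, which is preserved by differences. *)
Lemma K_rel_stiso x : x \in mspan (@K_rel A) ->
  exists s t, x = gsum s - gsum t /\ stiso (dsum s) (dsum t).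
Proof.
pose I : {pred code_free A} := fun x =>
  `[< exists s t, x = gsum s - gsum t /\ stiso (dsum s) (dsum t) >].
have cI : submod_closed I.
  apply: int_submod.
    apply/asboolP; exists [::], [::]; rewrite subrr; split=> //;
      exact: stiso_refl.
  move=> y z /asboolP[s [t [-> h]]] /asboolP[s' [t' [-> h']]]; apply/asboolP.
  exists (s ++ t'), (t ++ s'); split.
    by rewrite !gsum_cat opprB opprD addrACA [_ + gsum t']addrC addrACA addrA.
  apply: stiso_trans (miso_stiso (dsum_cat _ _)) _.
  apply: stiso_trans (miso_stiso (miso_sym (dsum_cat _ _))).
  exact: stiso_prod h (stiso_sym h').
move=> hx; apply/asboolP; apply: (mspan_min cI _ hx) => y [N S T h|P h];
  apply/asboolP.
  exists [:: N : {classic _}], [:: S : {classic _}; T : {classic _}]; split.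
    by rewrite /gsum !big_cons !big_nil !addr0 opprD addrA.
  apply: miso_stiso => /=; apply: miso_trans (miso_prod0 _ (@zero_rV _)) _.
  apply: miso_trans h _; apply: miso_prod; first exact: miso_refl.
  exact/miso_sym/miso_prod0/zero_rV.
exists [:: P : {classic _}], [::]; split.
  by rewrite /gsum big_cons !big_nil addr0 subr0.
apply: stiso_trans (stiso_proj0 h); apply: miso_stiso.
exact/miso_prod0/zero_rV.
Qed.

Lemma stiso_cancel T X Y : fingen T -> fingen X ->
  stiso (T * X)%type (T * Y)%type -> stiso X Y.
Proof.
move=> fT fX /(stiso_miso (fingen_prod fT fX))[C [n [pC h]]].
apply: (miso_proj_stiso pC (@projective_rV A n)).
apply: (fingen_cancel ccA fT).
apply: miso_trans (miso_prodA _ _ _) _; apply: miso_trans h _.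
exact: miso_sym (miso_prodA _ _ _).
Qed.

(** Equality of the classes only gives [dsum t + c ~ dsum t + d] for some [t]. *)
Lemma Kclass_stiso c d : Kclass c = Kclass d -> stiso (decode c) (decode d).
Proof.
move=> /mprojP/K_rel_stiso[s [t [e h]]].
have /gsum_perm/dsum_perm h' :
  gsum ((c : {classic _}) :: t) = gsum ((d : {classic _}) :: s).
  rewrite /gsum !big_cons -/(gsum s) -/(gsum t).
  apply/eqP; rewrite -subr_eq0 opprD addrACA e.
  by rewrite -[gsum t - _]opprB subrr.
apply: (@stiso_cancel (dsum t)); [exact: dsum_fingen|exact: decode_fingen|].
apply: stiso_trans (miso_stiso (miso_prodC _ _)) _.
apply: stiso_trans (miso_stiso h') _ => /=.
apply: stiso_trans (miso_stiso (miso_prodC _ _)) _.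
exact: stiso_prod h (stiso_refl _).
Qed.

(** ** The syzygy homomorphism *)

Lemma syz_Kclass c d c' d' : syz (decode c) (decode c') -> syz (decode d)
  (decode d') ->
  stiso (decode c) (decode d) -> Kclass c' = Kclass d'.
Proof. by move=> h h' cd; apply: stiso_Kclass; exact: syz_stiso h h' cd. Qed.

(** Any syzygy may serve, minimal or not: by Schanuel's lemma, in the form of
    [syz_stiso], its class depends only on the stable isomorphism class. *)
Lemma syzygy_map_exists : exists w : {additive Kgroup A -> Kgroup A},
  is_syzygy_map w.
Proof.
have [N hN] := choice (fun c => syz_exists ccA (decode_fingen c)).
pose f : {linear {freeg {classic (fgcode A)} / int} -> Kgroup A} :=
  fglift (fun c : {classic (fgcode A)} => Kclass (N c)).
have fE c : f (code_gen c) = Kclass (N c) by exact: fgliftE.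
have f0 x : K_rel x -> f x = 0.
  case=> [C S T h|P h]; last first.
    rewrite fE; apply: Kclass_proj.
    have [c hc] := code_exists (@fingen_rV A 0).
    have s0 : syz (decode P) 'rV[A]_0.
      exists (decode P), \0, idfun; split=> //; split=> [u v _|u|u].
      - by rewrite (@zero_rV _ u) (@zero_rV _ v).
      - by exists u.
      - by split=> [/= ->|[y <-] //]; exists 0.
    have := syz_stiso (hN P) s0 (stiso_refl _).
    move=> /(stiso_miso (decode_fingen _))[D [n [pD hD]]].
    apply: (projective_summand _ (@projective_rV A n)).
    apply: summand_trans (summandl _ D) _; apply: miso_summand.
    exact: miso_trans hD (miso_0prod _ (@zero_rV _)).
  rewrite !linearB /= !fE; apply/eqP; rewrite -addrA -opprD subr_eq0; apply/eqP.
  have [e he] := code_exists (fingen_prod (decode_fingen (N S))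
    (decode_fingen (N T))).
  rewrite -(Kclass_sum he); apply: stiso_Kclass.
  apply: stiso_trans (miso_stiso (miso_sym he)).
  exact: syz_stiso (hN C) (syz_prod (hN S) (hN T)) (miso_stiso h).
exists (mquot_lift f0 : {linear Kgroup A -> Kgroup A}) => M M' h.
rewrite [LHS]mquot_liftE fE.
exact: syz_Kclass (hN M) (is_syzygy_syz h) (stiso_refl _).
Qed.

Lemma is_syzygy_exists c : exists d, is_syzygy (decode c) (decode d).
Proof.
have [P [p [hp fP]]] := proj_cover_exists ccA (decode_fingen c).
have fk : fingen (mker p) by exact: fingen_mker.
have [d /misoE[f [g [fK gK]]]] := code_exists fk.
exists d, P, p, (mker_val (f := p) \o f); split=> //.
  by apply: inj_comp (@mker_valI _ _ _ p) _; exact: can_inj fK.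
move=> x; split=> [/mkerE[k <-]|[y <-]]; first by exists (g k); rewrite /= gK.
exact: mker_eq0.
Qed.

(** Since projective covers exist, every additive map that is correct on minimal
    syzygies is determined on all classes. *)
Lemma Omega_syz c d : syz (decode c) (decode d) ->
  Omega A (Kclass c) = Kclass d.
Proof.
move=> h; rewrite /Omega; case: pselect => [e|]; last by case;
  exact: syzygy_map_exists.
case: cid => w hw /=; have [d' h'] := is_syzygy_exists c.
by rewrite (hw _ _ h'); exact: syz_Kclass (is_syzygy_syz h') h (stiso_refl _).
Qed.

(** * The subgroup of a module and the function phi *)

Definition Kgens M : set (Kgroup A) :=
  [set y | exists c, y = Kclass c /\
    [/\ indecomposable (decode c), ~ projective (decode c)
      & summand (decode c) M]].

Lemma KspanE M x : Kspan M x <-> x \in mspan (Kgens M). Proof. by []. Qed.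

(** By the Krull-Schmidt property every generator is the class of a member of a
    fixed decomposition of [M]. *)
Lemma Kspan_fingen M : fingen M ->
  exists s : seq (Kgroup A), {subset mspan (Kgens M) <= mspan (gens s)}.
Proof.
move=> /(fingen_decomposed ccA)[s [hs h]].
exists [seq Kclass (d : fgcode A) | d <- s]; apply: mspan_min;
  first exact: mspan_submod.
move=> y [c [-> [ic _ cM]]].
have [d ds cd] := summand_dsum ccA (decode_fingen c) ic
  (summand_trans cM (miso_summand h)).
rewrite (@stiso_Kclass c d); first by apply: mspan_gen; apply: map_f.
exact/miso_stiso/(summand_indec ic.1 (hs _ ds) cd).
Qed.

Lemma iter_Omega_linear n : forall x y, iter n (Omega A)
  (x - y) = iter n (Omega A) x - iter n (Omega A) y.
Proof. by elim: n => [//|n IH] x y; rewrite !iterS IH raddfB. Qed.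

Lemma iter_Omega0 n : iter n (Omega A) 0 = 0.
Proof. by have := iter_Omega_linear n 0 0; rewrite !subrr. Qed.

Lemma Omega_stableP M n : Omega_stable M n <->
  forall m, (n <= m)%N -> forall x, Kspan M x ->
    iter m.+1 (Omega A) x = 0 -> iter m (Omega A) x = 0.
Proof.
split=> h m nm.
  have [_ inj _] := h m nm; move=> x Mx hx.
  have M0 : Kspan M 0 by apply/KspanE; exact: rpred0.
  rewrite -(iter_Omega0 m); apply: inj; rewrite ?inE;
    [by exists x|by exists 0|].
  by rewrite iter_Omega0 raddf0.
split.
- by move=> _ [x Mx <-]; exists x.
- move=> y y'; rewrite !inE => -[x Mx <-] [x' Mx' <-] e.
  apply/eqP; rewrite -subr_eq0 -iter_Omega_linear; apply/eqP; apply: (h m nm).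
    by move/KspanE: Mx => Mx; move/KspanE: Mx' => Mx'; apply/KspanE;
      rewrite rpredB.
  by rewrite iter_Omega_linear !iterS e subrr.
- by move=> _ [x Mx <-]; exists (iter m (Omega A) x) => //; exists x.
Qed.

(** [<M>] is a finitely generated abelian group, so the kernels of the powers of
    [Omega] on it stabilise. *)
Lemma Omega_stable_exists M : fingen M -> exists n, Omega_stable M n.
Proof.
move=> /Kspan_fingen[s hs].
pose I n : {pred Kgroup A} :=
  predI_submod (mspan (Kgens M)) [pred x | iter n (Omega A) x == 0].
have [|n|n x|n hn] := @cc_gens int (Kgroup A) true s I int_acc.
- move=> n; apply: setI_submod; first exact: mspan_submod.
  apply: int_submod => [|x y /eqP hx /eqP hy]; apply/eqP;
    first exact: iter_Omega0.
  by rewrite iter_Omega_linear hx hy subrr.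
- move=> x; rewrite !in_predI_submod => /andP[-> /eqP hx].
  by rewrite inE iterS hx raddf0 eqxx.
- by rewrite in_predI_submod => /andP[/hs].
exists n; apply/Omega_stableP => m nm x /KspanE Mx hx.
have : x \in I m.+1 by rewrite in_predI_submod Mx inE hx eqxx.
by rewrite hn ?(leq_trans nm) // -(hn m nm) in_predI_submod => /andP[_ /eqP].
Qed.

Lemma phiP M : fingen M -> Omega_stable M (phi M) /\
  forall k, Omega_stable M k -> (phi M <= k)%N.
Proof.
move=> fM; have ex : exists n, `[< Omega_stable M n >].
  by have [n hn] := Omega_stable_exists fM; exists n; apply/asboolP.
pose Q := [set n | Omega_stable M n /\ forall k, Omega_stable M k ->
  (n <= k)%N].
apply: (@xgetPex _ 0%N Q).
case: (ex_minnP ex) => n /asboolP hn hmin; exists n; split=> // k hk.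
by apply: hmin; apply/asboolP.
Qed.

End KGroup.

(** * Elements of <M> as differences of classes from add(M) *)

Section SpanAdd.
Variable A : nzRingType.
Hypothesis ccA : forall b, chain_cond (A^o : lmodType A) b.
Implicit Types M X Y Z V : lmodType A.
Implicit Types s t : seq {classic (fgcode A)}.

Definition ksum s : Kgroup A := \sum_(d <- s) Kclass (d : fgcode A).

Lemma ksum_cat s t : ksum (s ++ t) = ksum s + ksum t.
Proof. by rewrite /ksum big_cat. Qed.

Definition ind_summands M s : Prop := forall c : fgcode A,
  (c : {classic _}) \in s ->
  indecomposable (decode c) /\ summand (decode c) M.

Lemma Kspan_ksum M x : Kspan M x ->
  exists s t, [/\ ind_summands M s, ind_summands M t & x = ksum s - ksum t].
Proof.
pose I : {pred Kgroup A} := fun x => `[< exists s t,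
  [/\ ind_summands M s, ind_summands M t & x = ksum s - ksum t] >].
have indC s t : ind_summands M s -> ind_summands M t -> ind_summands M (s ++ t).
  by move=> hs ht c; rewrite mem_cat => /orP[/hs|/ht].
have ind0 : ind_summands M [::] by [].
have cI : submod_closed I.
  apply: int_submod.
    by apply/asboolP; exists [::], [::]; rewrite subrr.
  move=> y z /asboolP[s [t [hs ht ->]]] /asboolP[s' [t' [hs' ht' ->]]];
    apply/asboolP.
  exists (s ++ t'), (t ++ s'); split; try exact: indC.
  by rewrite !ksum_cat opprB opprD addrACA [_ + ksum t']addrC addrACA addrA.
move=> /KspanE hx; apply/asboolP; apply: (mspan_min cI _ hx) =>
  y [c [-> [ic _ cM]]].
apply/asboolP; exists [:: c : {classic _}], [::]; split=> //.
  by move=> d; rewrite inE => /eqP->.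
by rewrite /ksum big_cons !big_nil addr0 subr0.
Qed.

(** A shortest expression has no cancellation. *)
Lemma Kspan_reduced M x : Kspan M x ->
  exists s t, [/\ ind_summands M s, ind_summands M t, x = ksum s - ksum t
    & forall c d : fgcode A, (c : {classic _}) \in s ->
      (d : {classic _}) \in t ->
        ~ miso (decode c) (decode d)].
Proof.
move=> /Kspan_ksum[s [t [hs ht ->]]].
have [n le_n] := ubnP (size s); elim: n => // n IH in s t hs ht le_n *.
have [[c [d [cs dt cd]]]|h] := EM (exists c d : fgcode A,
   [/\ (c : {classic _}) \in s, (d : {classic _}) \in t & miso (decode c)
     (decode d)]); last first.
  by exists s, t; split=> // c d cs dt cd; apply: h; exists c, d.
have rem_ind r e : ind_summands M r -> ind_summands M (rem e r).
  by move=> hr a /mem_rem; exact: hr.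
have rem_sum r (e : {classic (fgcode A)}) : e \in r ->
  ksum r = Kclass (e : fgcode A) + ksum (rem e r).
  by move=> er; rewrite /ksum (perm_big _ (perm_to_rem er)) big_cons.
have [|s' [t' [hs' ht' e h]]] := IH (rem (c : {classic _}) s)
  (rem (d : {classic _}) t) (rem_ind _ _ hs) (rem_ind _ _ ht).
  by rewrite size_rem //; case: (s) cs le_n.
exists s', t'; split=> //; rewrite -e (rem_sum s c cs) (rem_sum t d dt).
by rewrite (stiso_Kclass (miso_stiso cd)) opprD addrACA subrr add0r.
Qed.

Lemma in_add_dsum M s : ind_summands M s -> in_add M (dsum s).
Proof.
elim: s => [|c s IH] hs.
  exists 0%N, {ffun 'I_0 -> M}; exact/miso_0prod/zero_rV.
have [|n [T h]] := IH; first by move=> d ds; apply: hs; rewrite in_cons ds orbT.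
have [_ [U h']] := hs c (mem_head _ _).
exists n.+1, (U * T)%type => /=; apply: miso_trans (miso_sym (ffunS_miso M n)).
apply: miso_trans (miso_prod h' h).
apply: miso_trans (miso_sym (miso_prodA _ _ _)) _.
apply: miso_trans (miso_prodA _ _ _); apply: miso_prod; first exact: miso_refl.
exact: miso_prodCA.
Qed.

Lemma in_add_zero M Z : is_zero Z -> in_add M Z.
Proof. by move=> Z0; exists 0%N, {ffun 'I_0 -> M}; exact: miso_0prod. Qed.

Lemma in_add_summand M X V : fingen V -> indecomposable V -> summand V X ->
  in_add M X -> summand V M.
Proof.
move=> fV iV VX [n XM]; apply: (summand_ffun ccA fV iV (n := n)).
exact: summand_trans VX XM.
Qed.

(** An indecomposable summand of a common summand would be isomorphic to a
    member of [s] and to a member of [t]. *)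
Lemma add_dsum_disjoint s t : 
  (forall c : fgcode A, (c : {classic _}) \in s -> indecomposable (decode c)) ->
  (forall c : fgcode A, (c : {classic _}) \in t -> indecomposable (decode c)) ->
  (forall c d : fgcode A, (c : {classic _}) \in s -> (d : {classic _}) \in t ->
     ~ miso (decode c) (decode d)) ->
  forall Z, fingen Z -> in_add (dsum s) Z /\ in_add (dsum t) Z <-> is_zero Z.
Proof.
move=> is_ it h Z fZ; split=> [[Zs Zt]|Z0]; last by split; exact: in_add_zero.
have [r [hr Zr]] := fingen_decomposed ccA fZ.
case: r => [|c r] in hr Zr.
  exact: miso_zero (miso_sym Zr) (@zero_rV _).
have ic := hr c (mem_head _ _); have fc := decode_fingen c.
have cZ : summand (decode c) Z.
  by apply: summand_trans (miso_summand (miso_sym Zr)); exact: summandl.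
have [a as_ ca] := summand_dsum ccA fc ic (in_add_summand fc ic cZ Zs).
have [b bt cb] := summand_dsum ccA fc ic (in_add_summand fc ic cZ Zt).
case: (h a b as_ bt); apply: miso_trans (summand_indec ic.1 (it _ bt) cb).
exact: miso_sym (summand_indec ic.1 (is_ _ as_) ca).
Qed.

(** The projective indecomposable summands have class zero, and the other ones
    are generators. *)
Lemma in_add_Kspan M X c : fingen X -> in_add M X -> miso (decode c) X ->
  Kspan M (Kclass c).
Proof.
move=> fX XM cX; have [s [hs Xs]] := fingen_decomposed ccA fX.
apply/KspanE; rewrite (Kclass_dsum (miso_trans cX Xs)).
have sX : forall d, d \in s -> summand (decode d) X.
  move=> d ds; apply: summand_trans (miso_summand (miso_sym Xs)).
  elim: (s) ds => // e r IH; rewrite in_cons => /orP[/eqP->|/IH dr];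
    first exact: summandl.
  exact: summand_trans dr (summandr _ _).
rewrite big_seq rpred_sum // => d ds; have id := hs _ ds.
have [pd|nd] := EM (projective (decode d));
  first by rewrite (Kclass_proj pd) rpred0.
apply: mspan_gen; exists d; split=> //; split=> //.
exact: in_add_summand (decode_fingen d) id (sX _ ds) XM.
Qed.

End SpanAdd.

(** * Tor and the powers of the syzygy map *)

Section Main.
Variables (R : comNzRingType) (A : algType R).
Hypothesis ccA : forall b, chain_cond (A^o : lmodType A) b.
Implicit Types X Y U V : lmodType A.

(** The standard presentation of the [d]-th standard syzygy may be replaced by
    a finite presentation of a finitely generated module stably isomorphic to
    it. *)
Lemma tor_stiso d U V X Y : fingen X -> fingen Y ->
  stiso (nsyz d U) X -> stiso (nsyz d V) Y ->
  nat_iso (TorF d.+1 U) (TorF d.+1 V) -> stiso X Y.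
Proof.
move=> fX fY UX VY h.
have [m [n [B [p pP]]]] := fingen_presents ccA fX.
have [m' [n' [B' [p' pP']]]] := fingen_presents ccA fY.
apply: (tor_stiso_presented pP pP').
have comp (W Z : lmodType A) k (q : {linear 'rV[A]_k -> Z}) : surj q ->
  stiso (nsyz d W) Z ->
    nat_iso (TorF d.+1 W) (tens_kerF (mker_val (f := q))).
  move=> qS WZ; apply: nat_iso_trans (tor_nat_iso d W) _.
  apply: homotopic_nat_iso; apply: stiso_homotopic WZ.
  - exact: projective_free.
  - exact: projective_rV.
  - exact/mker_exact/free_cover_surj.
  - exact: mker_exact.
apply: nat_iso_trans (nat_iso_sym (comp _ _ _ _ pP.1 UX)) _.
exact: nat_iso_trans h (comp _ _ _ _ pP'.1 VY).
Qed.

Lemma iter_Omega n X c : miso (decode c) X ->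
  exists d, stiso (nsyz n X) (decode d) /\ iter n (Omega A)
    (Kclass c) = Kclass d.
Proof.
move=> cX; elim: n => [|n [d [hd e]]].
  by exists c; split=> //; exact/stiso_sym/miso_stiso.
have [d' hd'] := syz_exists ccA (decode_fingen d).
exists d'; split; last by rewrite iterS e; exact: Omega_syz.
exact: syz_stiso (nsyz_syz n X) hd' hd.
Qed.

(** Both sides say that the [n]-th syzygies of [X] and [Y] are stably
    isomorphic. *)
Lemma tor_iso_Omega n X Y c d : miso (decode c) X -> miso (decode d) Y ->
  nat_iso (TorF n.+1 X) (TorF n.+1 Y) <->
  iter n (Omega A) (Kclass c) = iter n (Omega A) (Kclass d).
Proof.
move=> cX dY; have [c' [hc ec]] := iter_Omega n cX; have [d' [hd ed]] :=
  iter_Omega n dY.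
rewrite ec ed; split=> h.
  apply: (stiso_Kclass).
  exact: tor_stiso (decode_fingen _) (decode_fingen _) hc hd h.
apply: stiso_tor; apply: stiso_trans hc _.
apply: stiso_trans (stiso_sym hd); exact: Kclass_stiso.
Qed.

End Main.

Theorem mainTheorem2 (R : comNzRingType) (A : algType R)
    (hA : artin_algebra A) (M : fgmod A) :
  is_max
    ([set 0%N] `|`
     [set d : nat | (0 < d)%N /\
        exists X Y : fgmod A,
          [/\ in_add M X /\ in_add M Y,
              (forall Z : fgmod A, in_add X Z /\ in_add Y Z <-> is_zero Z),
              ~ nat_iso (TorF d X) (TorF d Y)
            & nat_iso (TorF d.+1 X) (TorF d.+1 Y)]])
    (phi M).
Proof.
have ccA b : chain_cond (A^o : lmodType A) b by exact: artin_algebra_cc.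
have [stab_phi min_phi] := phiP ccA (fgmodP M).
split; last first.
  (* If [phi M <= d], then [Omega] is injective on the [d]-th image, which
     contains the difference of the images of the classes of [X] and [Y]. *)
  move=> d [->//|[d0 [X [Y [[XM YM] _ nd sd]]]]].
  case: d d0 nd sd => // d _ nd sd; rewrite ltnNge; apply/negP => le_phi;
    apply: nd.
  have [c cX] := code_exists (fgmodP X); have [e eY] := code_exists (fgmodP Y).
  apply/(tor_iso_Omega ccA d cX eY); apply/eqP; rewrite -subr_eq0; apply/eqP.
  rewrite -iter_Omega_linear; move/Omega_stableP: stab_phi; apply=> //.
    have /KspanE hc := in_add_Kspan ccA (fgmodP X) XM cX.
    have /KspanE he := in_add_Kspan ccA (fgmodP Y) YM eY.
    by apply/KspanE; rewrite rpredB.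
  by rewrite iter_Omega_linear ((tor_iso_Omega ccA d.+1 cX eY).1 sd) subrr.
(* Minimality of [phi M = d.+1]: [Omega] is not injective on the [d]-th image. *)
case e : (phi M) => [|d]; [by left|right; split=> //].
have [x [Mx x1 x0]] : exists x, [/\ Kspan M x, iter d.+1 (Omega A) x = 0
    & iter d (Omega A) x <> 0].
  apply: contrapT => h; have /min_phi : Omega_stable M d.
    apply/Omega_stableP => m; rewrite leq_eqVlt => /orP[/eqP<- x Mx x1|dm].
      by apply: contrapT => x0; apply: h; exists x.
    by move/Omega_stableP: stab_phi; apply; rewrite e.
  by rewrite e ltnn.
have [s [t [hs ht ex dis]]] := Kspan_reduced Mx.
have [c cs] := code_exists (dsum_fingen s); have [c' ct] :=
  code_exists (dsum_fingen t).
have exc : x = Kclass c - Kclass c' by rewrite ex (Kclass_dsum cs)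
  (Kclass_dsum ct).
exists (FGMod (dsum_fingen s)), (FGMod (dsum_fingen t)); split.
- by split; exact: in_add_dsum.
- move=> Z; apply: (add_dsum_disjoint ccA) dis _ (fgmodP Z).
    by move=> a /hs[].
  by move=> a /ht[].
- move=> /(tor_iso_Omega ccA d cs ct) h; apply: x0.
  by rewrite exc iter_Omega_linear h subrr.
apply/(tor_iso_Omega ccA d.+1 cs ct)/eqP;
  rewrite -subr_eq0 -iter_Omega_linear -exc.
exact/eqP.
Qed.
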